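(* Let $n$ be a positive integer, let $\gamma: S^n\to \mathbb{R}_+$ be a $C^\infty$ strictly convex integrand and let $\delta: S^n\to \mathbb{R}_+$ be the dual convex integrand of $\gamma$. Suppose that $\gamma$ is stable. Then the following hold: (1) A point $\theta_0\in S^n$ is a non-degenerate critical point of $\gamma$ if and only if its antipodal point $-\theta_0\in S^n$ is a non-degenerate critical point of $\delta$. (2) Suppose that a point $\theta_0\in S^n$ is a non-degenerate critical point of $\gamma$. Then, for any integer $i$ with $0\le i\le n$, the Morse index of $\gamma$ at $\theta_0$ is $i$ if and only if the Morse index of $\delta$ at $-\theta_0$ is $n-i$.
   Context: $\mathbb{R}_+$ is the set of positive real numbers; $S^n$ is the unit sphere of $\mathbb{R}^{n+1}$. A point of $\mathbb{R}^{n+1}-\{\mathbf 0\}$ is written in polar form $(\theta,r)$ with $\theta\in S^n$, $r>0$ (i.e. the point $r\theta$). The inversion $\mathrm{inv}:\mathbb{R}^{n+1}-\{\mathbf 0\}\to\mathbb{R}^{n+1}-\{\mathbf 0\}$ is $\mathrm{inv}(\theta,r)=(-\theta,1/r)$. For a continuous function $\gamma:S^n\to\mathbb{R}_+$, $\mathrm{graph}(\gamma)=\{(\theta,\gamma(\theta)) \mid \theta\in S^n\}\subset\mathbb{R}^{n+1}-\{\mathbf 0\}$ (polar form), and $\Gamma_\gamma$ is the boundary of the convex hull of $\mathrm{inv}(\mathrm{graph}(\gamma))$. A continuous function $\gamma:S^n\to\mathbb{R}_+$ is a convex integrand if $\Gamma_\gamma=\mathrm{inv}(\mathrm{graph}(\gamma))$.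 A convex integrand $\gamma$ is a strictly convex integrand if the convex hull of $\mathrm{inv}(\mathrm{graph}(\gamma))$ is strictly convex; a $C^\infty$ strictly convex integrand is a strictly convex integrand of class $C^\infty$. The Wulff shape associated with $\gamma$ is $\mathcal{W}_\gamma=\bigcap_{\theta\in S^n}\{x\in\mathbb{R}^{n+1}\mid x\cdot\theta\le\gamma(\theta)\}$, where $\cdot$ is the standard scalar product. The dual convex integrand (dual) of a convex integrand $\gamma$ is the convex integrand $\delta:S^n\to\mathbb{R}_+$ with $\mathrm{inv}(\mathrm{graph}(\delta))=\partial\mathcal{W}_\gamma$. $C^\infty(S^n,\mathbb{R}_+)$ is the set of $C^\infty$ functions $S^n\to\mathbb{R}_+$ with the Whitney $C^\infty$ topology. Two elements $\gamma_1,\gamma_2\in C^\infty(S^n,\mathbb{R}_+)$ are $\mathcal{A}$-equivalent if there exist $C^\infty$ diffeomorphisms $h:S^n\to S^n$ and $H:\mathbb{R}_+\to\mathbb{R}_+$ with $\gamma_1=H\circ\gamma_2\circ h^{-1}$. A $C^\infty$ function $\gamma\in C^\infty(S^n,\mathbb{R}_+)$ is stable if its $\mathcal{A}$-equivalence class is open in $C^\infty(S^n,\mathbb{R}_+)$. The Morse index of a $C^\infty$ function $\gamma$ at a non-degenerate critical point $\theta$ is the integer $i$ such that, in some coordinate neighborhood $(U,\varphi)$ of $\theta$ with $\varphi(\theta)=\mathbf 0$, $\gamma\circ\varphi^{-1}(x_1,\ldots,x_n)=\gamma(\theta)-x_1^2-\cdots-x_i^2+x_{i+1}^2+\cdots+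x_n^2$.
   Formalization: The dual convex integrand δ is additionally assumed to be of class C^∞; this does not follow (if the boundary of the convex hull has a zero-curvature point, as z = 1 − x⁴, δ need not be C² there), and (1) fails without it. *)

(* Defs.v *)
From HB Require Import structures.
From mathcomp Require Import all_boot all_order all_algebra.
From mathcomp Require Import all_classical all_reals all_analysis.

Set Implicit Arguments.
Unset Strict Implicit.
Unset Printing Implicit Defensive.

Import Order.TTheory GRing.Theory Num.Theory.
Import numFieldNormedType.Exports.

Local Open Scope classical_set_scope.
Local Open Scope ring_scope.

(** A function on S^n is represented by a function on the ambient space
    'rV[R]_n.+1; every definition below depends only on its values on S^n. *)

(* The library norm of 'rV[R]_n is the sup norm (which induces the usual
   topology), hence the separate Euclidean structure. *)
Definition dotp (R : realType) (n : nat) (x y : 'rV[R]_n) : R :=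
  \sum_(i < n) x 0 i * y 0 i.

Definition enorm (R : realType) (n : nat) (x : 'rV[R]_n) : R :=
  Num.sqrt (dotp x x).

Definition sphere (R : realType) (n : nat) : set 'rV[R]_n.+1 :=
  [set x | enorm x = 1].

Definition posR (R : realType) : set R := [set r | 0 < r].

(** ** Smooth maps *)

(* Meant for U open and V finite dimensional: f is C^(k+1) iff it is
   differentiable and all its directional derivatives are C^k. *)
Fixpoint Ck_on_open (R : realType) (V W : normedModType R) (k : nat)
    (U : set V) (f : V -> W) : Prop :=
  if k is k'.+1 then
    (forall x, U x -> differentiable f x) /\
    (forall v, Ck_on_open k' U ('D_v f))
  else forall x, U x -> {for x, continuous f}.

(* Smoothness on an arbitrary subset A: f is locally the restriction to A of a
   C^oo map defined on an open set. *)
Definition smooth_on (R : realType) (V W : normedModType R)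
    (A : set V) (f : V -> W) : Prop :=
  forall x, A x -> exists (U : set V) (F : V -> W),
    [/\ open U, U x, forall k, Ck_on_open k U F
      & forall y, A y -> U y -> f y = F y].

(* f is a C^oo diffeomorphism from A onto B with inverse g. *)
Definition diffeo (R : realType) (V W : normedModType R)
    (A : set V) (B : set W) (f : V -> W) (g : W -> V) : Prop :=
  [/\ forall x, A x -> B (f x) /\ g (f x) = x,
      forall y, B y -> A (g y) /\ f (g y) = y,
      smooth_on A f & smooth_on B g].

Definition Cinf_pos (R : realType) (n : nat) (g : 'rV[R]_n.+1 -> R) : Prop :=
  smooth_on (@sphere R n) (g : 'rV[R]_n.+1 -> R^o) /\
  forall x, sphere x -> 0 < g x.

(* A coordinate neighbourhood (U, phi) of S^n, together with psi = phi^-1. *)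
Definition chart (R : realType) (n : nat) (U : set 'rV[R]_n.+1)
    (phi : 'rV[R]_n.+1 -> 'rV[R]_n) (psi : 'rV[R]_n -> 'rV[R]_n.+1) : Prop :=
  [/\ exists2 W : set 'rV[R]_n.+1, open W & U = W `&` @sphere R n,
      open (phi @` U) & diffeo U (phi @` U) phi psi].

Definition partial (R : realType) (n : nat) (j : 'I_n) (f : 'rV[R]_n -> R) :
  'rV[R]_n -> R := 'D_(delta_mx 0 j) (f : 'rV[R]_n -> R^o).

Definition partials (R : realType) (n : nat) (s : seq 'I_n)
  (f : 'rV[R]_n -> R) : 'rV[R]_n -> R := foldr (@partial R n) f s.

(** ** Convex integrands and their duals *)

(* In polar form (theta, r) |-> (- theta, 1 / r). *)
Definition inversion (R : realType) (n : nat) (x : 'rV[R]_n) : 'rV[R]_n :=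
  let r := enorm x in let theta := r^-1 *: x in r^-1 *: (- theta).

Definition graph (R : realType) (n : nat) (g : 'rV[R]_n.+1 -> R) :
  set 'rV[R]_n.+1 := [set g x *: x | x in @sphere R n].

Definition convex_hull (R : realType) (n : nat) (A : set 'rV[R]_n) :
  set 'rV[R]_n := smallest (@convex_set R 'rV[R]_n) A.

Definition boundary (T : topologicalType) (A : set T) : set T :=
  closure A `\` interior A.

Definition strictly_convex (R : realType) (n : nat) (K : set 'rV[R]_n) : Prop :=
  forall (x y : 'rV[R]_n) (t : R), K x -> K y -> x != y -> 0 < t -> t < 1 ->
    interior K (t *: x + (1 - t) *: y).

Definition convex_integrand (R : realType) (n : nat) (g : 'rV[R]_n.+1 -> R) :
    Prop :=
  [/\ {within @sphere R n, continuous g}, forall x, sphere x -> 0 < g x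
    & boundary (convex_hull (@inversion R n.+1 @` graph g)) =
      @inversion R n.+1 @` graph g].

Definition strictly_convex_integrand (R : realType) (n : nat)
    (g : 'rV[R]_n.+1 -> R) : Prop :=
  convex_integrand g /\
  strictly_convex (convex_hull (@inversion R n.+1 @` graph g)).

Definition wulff (R : realType) (n : nat) (g : 'rV[R]_n.+1 -> R) :
  set 'rV[R]_n.+1 :=
  \bigcap_(theta in @sphere R n) [set x | dotp x theta <= g theta].

Definition dual_integrand (R : realType) (n : nat)
    (g d : 'rV[R]_n.+1 -> R) : Prop :=
  convex_integrand d /\ @inversion R n.+1 @` graph d = boundary (wulff g).

(** ** Whitney topology and stability *)

(* A subset of the jet space J^k(S^n, R_+) is encoded by its preimage O under
   (p, f) |-> j^k f(p), f in C^oo(S^n, R_+); this map is onto, since every jet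
   with positive target is the jet of a global function. The condition says
   that this subset is open for the topology of J^k given by the coordinates
   (phi p, partial derivatives of f \o phi^-1 of order <= k at phi p); it
   forces O p f to depend on j^k f(p) only. *)
Definition jet_open (R : realType) (n k : nat)
    (O : 'rV[R]_n.+1 -> ('rV[R]_n.+1 -> R) -> Prop) : Prop :=
  forall p f, sphere p -> Cinf_pos f -> O p f ->
  exists U phi psi (e : R), [/\ chart U phi psi, U p, 0 < e &
    forall q g, U q -> Cinf_pos g -> `|phi q - phi p| < e ->
      (forall s : seq 'I_n, (size s <= k)%N ->
        `|partials s (g \o psi) (phi q) - partials s (f \o psi) (phi p)| < e) ->
      O q g].

(* The sets {g | j^k g (S^n) is included in O}, for k in nat and O open in
   J^k(S^n, R_+), form a basis of the Whitney C^oo topology. *)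
Definition whitney_open (R : realType) (n : nat)
    (A : set ('rV[R]_n.+1 -> R)) : Prop :=
  forall f, Cinf_pos f -> A f -> exists k O, [/\ jet_open k O,
    forall p, sphere p -> O p f &
    forall g, Cinf_pos g -> (forall p, sphere p -> O p g) -> A g].

Definition A_equivalent (R : realType) (n : nat) (g1 g2 : 'rV[R]_n.+1 -> R) :
    Prop :=
  exists (h h' : 'rV[R]_n.+1 -> 'rV[R]_n.+1) (H H' : R^o -> R^o),
    [/\ diffeo (@sphere R n) (@sphere R n) h h',
        diffeo (@posR R : set R^o) (@posR R : set R^o) H H' &
        forall x, sphere x -> g1 x = H (g2 (h' x))].

Definition stable (R : realType) (n : nat) (g : 'rV[R]_n.+1 -> R) : Prop :=
  whitney_open [set f | Cinf_pos f /\ A_equivalent f g].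

(** ** Critical points *)

Definition hessian (R : realType) (n : nat) (f : 'rV[R]_n -> R)
  (x : 'rV[R]_n) : 'M[R]_n := \matrix_(i, j) partial i (partial j f) x.

Definition nondegenerate_critical_point (R : realType) (n : nat)
    (g : 'rV[R]_n.+1 -> R) (p : 'rV[R]_n.+1) : Prop :=
  exists U phi psi, [/\ chart U phi psi, U p,
    forall j : 'I_n, partial j (g \o psi) (phi p) = 0 &
    \det (hessian (g \o psi) (phi p)) != 0].

Definition morse_index (R : realType) (n : nat)
    (g : 'rV[R]_n.+1 -> R) (p : 'rV[R]_n.+1) (i : nat) : Prop :=
  exists U phi psi, [/\ chart U phi psi, U p, phi p = 0 &
    forall x, (phi @` U) x ->
      g (psi x) = g p - \sum_(j < n | (j < i)%N) x 0 j ^+ 2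
                      + \sum_(j < n | (i <= j)%N) x 0 j ^+ 2].

(* Main.v *)
Require Import Defs.
From mathcomp Require Import all_boot all_order all_algebra.
From mathcomp Require Import all_classical all_reals all_analysis.
From mathcomp Require Import ring lra.
Set Implicit Arguments.
Unset Strict Implicit.
Unset Printing Implicit Defensive.
Import Order.TTheory GRing.Theory Num.Theory.
Import numFieldNormedType.Exports.
Local Open Scope classical_set_scope.
Local Open Scope ring_scope.

(** Extend g to the positively 1-homogeneous function G and set
    [gauss g x = - grad G x / |grad G x|].  Convexity of g and the definition of
    the dual d amount to [- <theta, eta> <= g theta * d eta] on the sphere, with
    equality iff [eta = gauss g theta] iff [theta = gauss d eta].  So the two
    Gauss maps are inverse diffeomorphisms of the sphere,
    [d (gauss g theta) = 1 / |grad G theta|], and everything is symmetric in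
    (g, d).

    Fix a chart with inverse psi, put [f = g o psi], [p = grad G o psi], let J and
    P be the matrices whose rows are the partial derivatives of psi and p, and
    transport the chart by the Gauss map, so that d becomes [1 / |p|].  Since
    [<psi, D p> = 0] and [<psi, D psi> = 0], one has [P = M J] with M invertible,
    and at a critical point, where [p = f psi],
      [hess f = (P - f J) J^T],   [hess (|p|^2 / 2) = (P - f J) P^T = hess f * M^T].
    This is the statement on non-degeneracy.

    If the chart is a Morse chart, [f x = r + x E x^T] with E diagonal with
    entries -1 and 1, then with [G x = J J^T]
      [|p|^2 = f^2 + 4 x E (G x)^-1 E x^T],
    so [1 / |p| = 1 / r - x S(x) x^T] with S(x) an explicit smooth symmetric
    matrix.  S(0) is positive on the positive space of E, and its inverse,
    proportional to [E - 2 (2 E + r G 0)^-1], is negative on the negative space of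
    E, because [2 E + r G 0] is positive by the support inequality.  Hence a smooth
    Cholesky decomposition of a block of S and of its Schur complement,
    followed by the inverse function theorem, gives a Morse chart of d with
    complementary index. *)

(** * Smooth maps on open sets *)

Definition Cinf (R : realType) (V W : normedModType R) (U : set V) (f : V -> W) : Prop :=
  forall k, Ck_on_open k U f.

Section Calculus.
Context {R : realType}.
Implicit Types V W X : normedModType R.

(** ['D_v f] is an ambient derivative, so the recursion only ever tests individual points of [U].
    Restriction to subsets and gluing along covers follow at once from this pointwise form. *)
Lemma Ck_on_open_set1 V W k (U : set V) (f : V -> W) :
  Ck_on_open k U f <-> forall x, U x -> Ck_on_open k [set x] f.
Proof.
elim: k f => [|k IH] f /=.
  by split=> [h x Ux y ->|h x Ux]; [exact: h|exact: (h x Ux x erefl)].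
split=> [[d h] x Ux|h]; first split.
- by move=> y ->; exact: d.
- by move=> v; exact: ((IH _).1 (h v)).
- split=> [x Ux|v]; first exact: ((h x Ux).1 x erefl).
  by apply/IH => x Ux; exact: ((h x Ux).2 v).
Qed.

Lemma Ck_on_open_sub V W k (U U' : set V) (f : V -> W) :
  U' `<=` U -> Ck_on_open k U f -> Ck_on_open k U' f.
Proof. by move=> UU /Ck_on_open_set1 h; apply/Ck_on_open_set1 => x /UU; exact: h. Qed.

Lemma differentiable_eps V W (f : V -> W) (L : {linear V -> W}) x :
  continuous L ->
  (forall e : R, 0 < e -> \forall h \near (0 : V), `|f (h + x) - f x - L h| <= e * `|h|) ->
  differentiable f x.
Proof.
move=> Lc fL.
have dxf : f \o shift x = cst (f x) + L +o_0 id.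
  apply/eqaddoP => e e0; near=> h.
  rewrite /= !fctE opprD addrA.
  by near: h; exact: fL.
have E := diff_unique Lc dxf.
apply/diff_locallyP; split; rewrite E //.
Unshelve. all: by end_near. Qed.

Lemma differentiable_approx V W (f : V -> W) x : differentiable f x ->
  forall e : R, 0 < e ->
  \forall h \near (0 : V), `|f (h + x) - f x - 'd f x h| <= e * `|h|.
Proof.
move=> /diff_locallyP[_ /eqaddoP h] e /h; apply: filterS => y.
by rewrite /= !fctE opprD addrA.
Qed.

Lemma near_eq_differentiable V W (f g : V -> W) x :
  {near x, f =1 g} -> differentiable f x -> differentiable g x.
Proof.
move=> fg fx; apply: (@differentiable_eps _ _ _ ('d f x)) => [|e e0].
  exact: diff_continuous.
have fgx : f x = g x by exact: nbhs_singleton fg.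
near=> h; rewrite -fgx -(_ : f (h + x) = g (h + x)).
  by near: h; exact: differentiable_approx.
near: h; move: fg; rewrite /prop_near1 /= [X in X -> _](near_shift 0 x).
by apply: filterS => y /=; rewrite subr0.
Unshelve. all: by end_near. Qed.

Lemma open_near_eq V W (U : set V) (f g : V -> W) x :
  open U -> U x -> (forall y, U y -> f y = g y) -> {near x, f =1 g}.
Proof.
move=> oU Ux fg; near=> y; apply: fg; near: y.
exact: open_nbhs_nbhs.
Unshelve. all: by end_near. Qed.

(** On an open set equality of functions is equality of germs, hence passes to all directional
    derivatives. The derivative rules below are computed pointwise on [U] and carried over by this
    lemma. *)
Lemma Ck_on_open_eq V W k (U : set V) (f g : V -> W) :
  open U -> (forall x, U x -> f x = g x) -> Ck_on_open k U f -> Ck_on_open k U g.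
Proof.
move=> oU; elim: k f g => [|k IH] f g fg /=.
  move=> cf x Ux; have fgx := open_near_eq oU Ux fg.
  suff : g @ x --> g x by [].
  have : f @ x --> f x by exact: cf.
  by rewrite (fg x Ux); apply: cvg_trans; exact: near_eq_cvg.
case=> df hf; split=> [x Ux|v].
  exact: (near_eq_differentiable (open_near_eq oU Ux fg) (df x Ux)).
apply: IH (hf v) => x Ux; apply: near_eq_derive.
exact: open_near_eq oU Ux fg.
Qed.

Lemma Ck_on_openS V W k (U : set V) (f : V -> W) :
  Ck_on_open k.+1 U f -> Ck_on_open k U f.
Proof.
elim: k f => [|k IH] f /= [df hf].
  by move=> x Ux; apply: differentiable_continuous; exact: df.
by split=> // v; apply: IH; exact: hf.
Qed.

Lemma Cinf_differentiable V W (U : set V) (f : V -> W) x :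
  Cinf U f -> U x -> differentiable f x.
Proof. by move=> /(_ 1)[+ _]; exact. Qed.

Lemma Cinf_continuous V W (U : set V) (f : V -> W) x :
  Cinf U f -> U x -> {for x, continuous f}.
Proof. by move=> /(_ 0); exact. Qed.

Lemma Cinf_derive V W (U : set V) (f : V -> W) v :
  Cinf U f -> Cinf U ('D_v f).
Proof. by move=> h k; have [_] := h k.+1; exact. Qed.

Lemma Cinf_sub V W (U U' : set V) (f : V -> W) :
  U' `<=` U -> Cinf U f -> Cinf U' f.
Proof. by move=> UU h k; exact: Ck_on_open_sub UU (h k). Qed.

Lemma Cinf_eq V W (U : set V) (f g : V -> W) :
  open U -> (forall x, U x -> f x = g x) -> Cinf U f -> Cinf U g.
Proof. by move=> oU fg h k; exact: Ck_on_open_eq oU fg (h k). Qed.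

Lemma Cinf_cover V W (U : set V) (f : V -> W) :
  (forall x, U x -> exists2 U' : set V, U' x & Cinf U' f) -> Cinf U f.
Proof.
move=> h k; apply/Ck_on_open_set1 => x /h[U' U'x /(_ k)].
by move/Ck_on_open_set1; exact.
Qed.

Lemma Ck_on_open_cst V W k (U : set V) (a : W) : Ck_on_open k U (cst a : V -> W).
Proof.
elim: k a => [|k IH] a /=; first by move=> x _; exact: cst_continuous.
split=> [x _|v]; first exact: differentiable_cst.
have -> : 'D_v (cst a : V -> W) = cst 0 by apply/funext => x; rewrite derive_cst.
exact: IH.
Qed.

Lemma Ck_on_openD V W k (U : set V) (f g : V -> W) : open U ->
  Ck_on_open k U f -> Ck_on_open k U g -> Ck_on_open k U (fun x => f x + g x).
Proof.
move=> oU; elim: k f g => [|k IH] f g /=.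
  by move=> cf cg x Ux; apply: cvgD; [exact: cf|exact: cg].
case=> df hf [dg hg]; split=> [x Ux|v].
  by apply: differentiableD; [exact: df|exact: dg].
apply: (Ck_on_open_eq oU) (IH _ _ (hf v) (hg v)) => x Ux /=.
rewrite [RHS](@deriveD _ _ _ f g x v) //; apply: diff_derivable; [exact: df|exact: dg].
Qed.

Lemma Ck_on_open_linear V W X k (U : set V) (f : V -> W) (L : {linear W -> X}) :
  continuous L -> open U -> Ck_on_open k U f -> Ck_on_open k U (L \o f).
Proof.
move=> Lc oU; elim: k f => [|k IH] f /=.
  by move=> cf x Ux; apply: continuous_comp; [exact: cf|exact: Lc].
case=> df hf; split=> [x Ux|v].
  by apply: differentiable_comp; [exact: df|exact: linear_differentiable].
apply: (Ck_on_open_eq oU) (IH _ (hf v)) => x Ux /=.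
have {}df := df x Ux; have dL : differentiable L (f x) by exact: linear_differentiable.
have dc := differentiable_comp df dL.
rewrite (deriveE _ dc) (deriveE _ df) (diff_comp df dL).
by rewrite (diff_lin (f x) Lc).
Qed.

(** The product rule involves [f] and [g] next to their derivatives, so the induction also uses both
    factors at the lower order. *)
Lemma Ck_on_openM V k (U : set V) (f g : V -> R^o) : open U ->
  Ck_on_open k U f -> Ck_on_open k U g ->
  Ck_on_open k U (fun x => f x * g x : R^o).
Proof.
move=> oU; elim: k f g => [|k IH] f g Cf Cg.
  by move=> x Ux; apply: cvgM; [exact: Cf|exact: Cg].
have Cf' := Ck_on_openS Cf; have Cg' := Ck_on_openS Cg.
case: Cf Cg => df hf [dg hg]; split=> [x Ux|v].
  by apply: (@differentiableM _ _ f g); [exact: df|exact: dg].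
apply: (Ck_on_open_eq oU) (Ck_on_openD oU (IH _ _ Cf' (hg v)) (IH _ _ Cg' (hf v))).
move=> x Ux /=.
rewrite [RHS](@deriveM _ _ f g x v) //; apply: diff_derivable; [exact: df|exact: dg].
Qed.

(** Since [D (1/f) = - (1/f)^2 D f], the regularity of [1/f] at order [k] gives that of its
    derivative; the square root below bootstraps in the same way. *)
Lemma Ck_on_openV V k (U : set V) (f : V -> R^o) : open U ->
  (forall x, U x -> f x != 0) ->
  Ck_on_open k U f -> Ck_on_open k U (fun x => (f x)^-1 : R^o).
Proof.
move=> oU f0; elim: k => [|k IH] Cf.
  by move=> x Ux; apply: cvgV; [exact: f0|exact: Cf].
have Cf' := IH (Ck_on_openS Cf).
case: Cf => df hf; split=> [x Ux|v].
  by apply: (@differentiableV _ _ f); [exact: df|exact: f0].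
have CN : Ck_on_open k U (cst (-1) : V -> R^o) by exact: Ck_on_open_cst.
apply: (Ck_on_open_eq oU) (Ck_on_openM oU CN (Ck_on_openM oU (Ck_on_openM oU Cf' Cf') (hf v))).
move=> x Ux /=.
rewrite [RHS](@deriveV _ _ f x v) ?f0//; last by apply: diff_derivable; exact: df.
by rewrite /cst mulN1r -exprVn -mulNr.
Qed.

Lemma differentiable_sqrt V (f : V -> R^o) x : 0 < f x -> differentiable f x ->
  differentiable (fun y => Num.sqrt (f y) : R^o) x /\
  forall v, 'D_v (fun y => Num.sqrt (f y) : R^o) x = (2 * Num.sqrt (f x))^-1 * 'D_v f x.
Proof.
move=> fx df.
have [ds es] := is_derive1_sqrt fx.
have ds' : differentiable (Num.sqrt : R^o -> R^o) (f x) by exact/derivable1_diffP.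
have dc := differentiable_comp df ds'.
split=> [|v]; first exact: dc.
rewrite (deriveE _ dc) (diff_comp df ds') (deriveE _ df) /=.
have -> : 'd (Num.sqrt : R^o -> R^o) (f x) ('d f x v) =
    ('d f x v) *: 'd (Num.sqrt : R^o -> R^o) (f x) (1 : R^o).
  by rewrite -linearZ /GRing.scale /= mulr1.
have -> : 'd (Num.sqrt : R^o -> R^o) (f x) (1 : R^o) = (2 * Num.sqrt (f x))^-1.
  by rewrite -(deriveE _ ds'); exact: es.
exact: mulrC.
Qed.

Lemma Ck_on_open_sqrt V k (U : set V) (f : V -> R^o) : open U ->
  (forall x, U x -> 0 < f x) ->
  Ck_on_open k U f -> Ck_on_open k U (fun x => Num.sqrt (f x) : R^o).
Proof.
move=> oU f0; elim: k => [|k IH] Cf.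
  move=> x Ux; apply: (@continuous_comp _ _ _ f (@Num.sqrt R)); first exact: Cf.
  exact: sqrt_continuous.
have Cf' := IH (Ck_on_openS Cf).
case: Cf => df hf; split=> [x Ux|v].
  by apply: (differentiable_sqrt _ _).1; [exact: f0|exact: df].
have CN : Ck_on_open k U (cst (2^-1) : V -> R^o) by exact: Ck_on_open_cst.
have s0 x : U x -> Num.sqrt (f x) != 0 by move=> Ux; rewrite gt_eqF ?sqrtr_gt0 ?f0.
apply: (Ck_on_open_eq oU) (Ck_on_openM oU CN (Ck_on_openM oU (Ck_on_openV oU s0 Cf') (hf v))).
move=> x Ux /=.
by rewrite (differentiable_sqrt (f0 x Ux) (df x Ux)).2 invfM mulrA.
Qed.

End Calculus.

(** * Algebra of smooth maps, row-valued maps and matrix entries *)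

Section CalculusRow.
Context {R : realType}.
Implicit Types V W X : normedModType R.

Lemma Cinf_cst V W (U : set V) (a : W) : Cinf U (fun=> a).
Proof. by move=> k; exact: Ck_on_open_cst. Qed.

Lemma Cinf_ext V W (U : set V) (f g : V -> W) :
  (forall x, f x = g x) -> Cinf U f -> Cinf U g.
Proof. by move=> /funext ->. Qed.

Lemma CinfD V W (U : set V) (f g : V -> W) : open U ->
  Cinf U f -> Cinf U g -> Cinf U (fun x => f x + g x).
Proof. by move=> oU hf hg k; exact: Ck_on_openD. Qed.

Lemma CinfM V (U : set V) (f g : V -> R^o) : open U ->
  Cinf U f -> Cinf U g -> Cinf U (fun x => f x * g x : R^o).
Proof. by move=> oU hf hg k; exact: Ck_on_openM. Qed.

Lemma CinfV V (U : set V) (f : V -> R^o) : open U ->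
  (forall x, U x -> f x != 0) ->
  Cinf U f -> Cinf U (fun x => (f x)^-1 : R^o).
Proof. by move=> oU f0 hf k; exact: Ck_on_openV. Qed.

Lemma Cinf_sqrt V (U : set V) (f : V -> R^o) : open U ->
  (forall x, U x -> 0 < f x) ->
  Cinf U f -> Cinf U (fun x => Num.sqrt (f x) : R^o).
Proof. by move=> oU f0 hf k; exact: Ck_on_open_sqrt. Qed.

Lemma CinfN V (U : set V) (f : V -> R^o) : open U ->
  Cinf U f -> Cinf U (fun x => - f x : R^o).
Proof.
move=> oU hf; apply: (Cinf_eq oU _ (CinfM oU (Cinf_cst U (-1 : R^o)) hf)) => x _.
by rewrite mulN1r.
Qed.

Lemma Ck_on_open_sum V W k I (r : seq I) (P : pred I) (U : set V) (f : I -> V -> W) :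
  open U -> (forall i, P i -> Ck_on_open k U (f i)) ->
  Ck_on_open k U (fun x => \sum_(i <- r | P i) f i x).
Proof.
move=> oU hf.
have -> : (fun x => \sum_(i <- r | P i) f i x) = \sum_(i <- r | P i) f i.
  by apply/funext => x; rewrite fct_sumE.
apply: (big_ind (fun F => Ck_on_open k U F)) => //.
- exact: Ck_on_open_cst.
- by move=> F G; exact: Ck_on_openD.
Qed.

Lemma Cinf_sum V W I (r : seq I) (P : pred I) (U : set V) (f : I -> V -> W) :
  open U -> (forall i, P i -> Cinf U (f i)) ->
  Cinf U (fun x => \sum_(i <- r | P i) f i x).
Proof. by move=> oU hf k; apply: Ck_on_open_sum => // i /hf; exact. Qed.

Lemma Cinf_prod V I (r : seq I) (P : pred I) (U : set V) (f : I -> V -> R^o) :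
  open U -> (forall i, P i -> Cinf U (f i)) ->
  Cinf U (fun x => \prod_(i <- r | P i) f i x : R^o).
Proof.
move=> oU hf; elim: r => [|i r IH].
  by apply: (Cinf_eq oU _ (Cinf_cst U (1 : R^o))) => x _; rewrite big_nil.
case Pi : (P i); last by apply: (Cinf_eq oU _ IH) => x _; rewrite big_cons Pi.
by apply: (Cinf_eq oU _ (CinfM oU (hf i Pi) IH)) => x _; rewrite big_cons Pi.
Qed.

Lemma Ck_on_open_scalel V W k (U : set V) (f : V -> R^o) (w : W) : open U ->
  Ck_on_open k U f -> Ck_on_open k U (fun x => f x *: w).
Proof.
move=> oU; elim: k f => [|k IH] f /=.
  by move=> cf x Ux; apply: cvgZr_tmp; exact: cf.
case=> df hf; split=> [x Ux|v].
  by apply: differentiableZl; exact: df.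
apply: (Ck_on_open_eq oU) (IH _ (hf v)) => x Ux /=.
have dx := df x Ux.
have dw : differentiable (fun y => f y *: w) x by exact: differentiableZl.
by rewrite (deriveE _ dx) (deriveE _ dw) diffZl.
Qed.

Lemma derive_row_mxE V m (f : V -> 'rV[R]_m) x v i j : differentiable f x ->
  'D_v f x i j = 'D_v (fun y => f y 0 j : R^o) x.
Proof.
by move=> df; rewrite derive_mx ?mxE ?(ord1 i) //; exact: diff_derivable.
Qed.

Lemma differentiable_entry V m (f : V -> 'rV[R]_m) x i j :
  differentiable f x -> differentiable (fun y => f y i j : R^o) x.
Proof.
move=> df; have h := @differentiable_coord R 1 m (f x) i j.
exact: (differentiable_comp df h).
Qed.

Lemma Ck_on_open_row V m k (U : set V) (f : V -> 'rV[R]_m) : open U ->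
  Ck_on_open k U f <-> forall j, Ck_on_open k U (fun x => f x 0 j : R^o).
Proof.
move=> oU; split.
  elim: k f => [|k IH] f /=.
    move=> cf j x Ux.
    apply: (@continuous_comp _ _ _ f (fun M : 'rV[R]_m => M 0 j)); first exact: cf.
    exact: coord_continuous.
  case=> df hf j; split=> [x Ux|v].
    by apply: differentiable_entry; exact: df.
  apply: (Ck_on_open_eq oU) (IH _ (hf v) j) => x Ux.
  by rewrite (derive_row_mxE _ _ _ (df x Ux)).
move=> hf.
have h := @Ck_on_open_sum V 'rV[R]_m k 'I_m (index_enum 'I_m) xpredT U
   (fun j x => f x 0 j *: delta_mx 0 j) oU.
apply: (Ck_on_open_eq oU) (h _) => [x _|j _]; first by rewrite -row_sum_delta.
exact: Ck_on_open_scalel.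
Qed.

Lemma Cinf_row V m (U : set V) (f : V -> 'rV[R]_m) : open U ->
  Cinf U f <-> forall j, Cinf U (fun x => f x 0 j : R^o).
Proof.
move=> oU; split=> [hf j k|hf k].
  by have /(Ck_on_open_row _ _ oU) := hf k; exact.
by apply/(Ck_on_open_row _ _ oU) => j; exact: hf.
Qed.

Lemma derive_comp_row V W m (f : V -> 'rV[R]_m) (g : 'rV[R]_m -> W) x v :
  differentiable f x -> differentiable g (f x) ->
  'D_v (g \o f) x = \sum_j 'D_v (fun y => f y 0 j : R^o) x *: 'D_(delta_mx 0 j) g (f x).
Proof.
move=> df dg; have dc := differentiable_comp df dg.
rewrite (deriveE _ dc) (diff_comp df dg) /= -(deriveE _ df).
rewrite [X in 'd g _ X]row_sum_delta linear_sum /=; apply: eq_bigr => j _.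
by rewrite linearZ/= -(deriveE _ dg) (derive_row_mxE _ _ _ df).
Qed.

(** By the chain rule in coordinates, a derivative of [g \o f] is a sum of products of a derivative
    of [f] with a partial derivative of [g] composed with [f]; the last factor is a composite to
    which the induction applies. *)
Lemma Ck_on_open_comp V m k (U : set V) (U' : set 'rV[R]_m)
    (f : V -> 'rV[R]_m) (g : 'rV[R]_m -> R^o) : open U ->
  (forall x, U x -> U' (f x)) ->
  Ck_on_open k U f -> Ck_on_open k U' g -> Ck_on_open k U (g \o f).
Proof.
move=> oU; elim: k g f => [|k IH] g f fU.
  move=> cf cg x Ux; apply: continuous_comp; [exact: cf|exact: cg (fU _ Ux)].
move=> Cf Cg; have Cf' := Ck_on_openS Cf.
have [df hf] := Cf; have [dg hg] := Cg.
split=> [x Ux|v].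
  by apply: differentiable_comp; [exact: df|exact: dg (fU _ Ux)].
have h := @Ck_on_open_sum V R^o k 'I_m (index_enum 'I_m) xpredT U
   (fun j x => 'D_v (fun y => f y 0 j : R^o) x * 'D_(delta_mx 0 j) g (f x)) oU.
apply: (Ck_on_open_eq oU) (h _) => [x Ux|j _].
  by rewrite derive_comp_row //; [exact: df|exact: dg (fU _ Ux)].
apply: Ck_on_openM => //; last exact: IH (hg _).
by have /(Ck_on_open_row _ _ oU)/(_ j)[_] := Cf; exact.
Qed.

Lemma Ck_on_open_comp_row V m p k (U : set V) (U' : set 'rV[R]_m)
    (f : V -> 'rV[R]_m) (g : 'rV[R]_m -> 'rV[R]_p) : open U -> open U' ->
  (forall x, U x -> U' (f x)) ->
  Ck_on_open k U f -> Ck_on_open k U' g -> Ck_on_open k U (g \o f).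
Proof.
move=> oU oU' fU Cf /(Ck_on_open_row _ _ oU') Cg.
by apply/(Ck_on_open_row _ _ oU) => j; exact: Ck_on_open_comp fU Cf (Cg j).
Qed.

Lemma Cinf_comp V m (U : set V) (U' : set 'rV[R]_m)
    (f : V -> 'rV[R]_m) (g : 'rV[R]_m -> R^o) : open U ->
  (forall x, U x -> U' (f x)) -> Cinf U f -> Cinf U' g -> Cinf U (g \o f).
Proof. by move=> oU fU Cf Cg k; exact: Ck_on_open_comp fU (Cf k) (Cg k). Qed.

Lemma Cinf_comp_row V m p (U : set V) (U' : set 'rV[R]_m)
    (f : V -> 'rV[R]_m) (g : 'rV[R]_m -> 'rV[R]_p) : open U -> open U' ->
  (forall x, U x -> U' (f x)) -> Cinf U f -> Cinf U' g -> Cinf U (g \o f).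
Proof. by move=> oU oU' fU Cf Cg k; exact: Ck_on_open_comp_row fU (Cf k) (Cg k). Qed.

Lemma Cinf_entry V m (U : set V) (f : V -> 'rV[R]_m) i j : open U ->
  Cinf U f -> Cinf U (fun x => f x i j : R^o).
Proof. by move=> oU /(Cinf_row _ oU)/(_ j); rewrite (ord1 i). Qed.

Lemma Cinf_id V (U : set V) : Cinf U (id : V -> V).
Proof.
case=> [|k]; first by move=> x _.
split=> [x _|v]; first exact: (@ex_diff _ _ _ _ _ id id).
have -> : 'D_v (id : V -> V) = cst v by apply/funext => x; rewrite derive_id.
exact: Ck_on_open_cst.
Qed.

Lemma Cinf_coord m (U : set 'rV[R]_m) i j : open U -> Cinf U (fun x : 'rV[R]_m => x i j : R^o).
Proof. by move=> oU; apply: Cinf_entry => //; exact: Cinf_id. Qed.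

Lemma Cinf_derive_delta V m (U : set V) (f : V -> 'rV[R]_m) v j : open U ->
  Cinf U f -> Cinf U (fun x => 'D_v f x 0 j : R^o).
Proof. by move=> oU Cf; apply: Cinf_entry => //; exact: Cinf_derive. Qed.

Lemma Cinf_det V m (U : set V) (A : V -> 'M[R]_m) : open U ->
  (forall i j, Cinf U (fun x => A x i j : R^o)) -> Cinf U (fun x => \det (A x) : R^o).
Proof.
move=> oU hA; apply: Cinf_sum => // s _; apply: CinfM => //; first exact: Cinf_cst.
by apply: Cinf_prod => // i _; exact: hA.
Qed.

(** Cramer's rule: an entry of the inverse is a cofactor over the determinant, both polynomial in
    the entries. *)
Lemma Cinf_invmx V m (U : set V) (A : V -> 'M[R]_m) i j : open U ->
  (forall x, U x -> A x \in unitmx) ->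
  (forall i j, Cinf U (fun x => A x i j : R^o)) ->
  Cinf U (fun x => invmx (A x) i j : R^o).
Proof.
move=> oU uA hA.
have h : Cinf U (fun x => (\det (A x))^-1 * cofactor (A x) j i : R^o).
  apply: CinfM => //.
    apply: CinfV => // [x Ux|]; last exact: Cinf_det.
    by have := uA x Ux; rewrite unitmxE unitfE.
  apply: CinfM => //; first exact: Cinf_cst.
  apply: Cinf_det => // k l.
  by apply: (Cinf_eq oU _ (hA (lift j k) (lift i l))) => x _; rewrite !mxE.
by apply: (Cinf_eq oU _ h) => x Ux; rewrite /invmx uA// !mxE.
Qed.

Lemma Cinf_mulmx V m n p (U : set V) (A : V -> 'M[R]_(m, n)) (B : V -> 'M[R]_(n, p)) i j :
  open U -> (forall i j, Cinf U (fun x => A x i j : R^o)) ->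
  (forall i j, Cinf U (fun x => B x i j : R^o)) ->
  Cinf U (fun x => (A x *m B x) i j : R^o).
Proof.
move=> oU hA hB.
have h := @Cinf_sum V R^o 'I_n (index_enum 'I_n) xpredT U (fun k x => A x i k * B x k j) oU.
apply: (Cinf_eq oU _ (h _)) => [x _|k _]; first by rewrite !mxE.
by apply: CinfM => //.
Qed.

End CalculusRow.

(** * Sup-norm estimates, Jacobian matrices and the mean value inequality *)

Section RowNorm.
Context {R : realType}.

Lemma row_entry_norm n (x : 'rV[R]_n) j : `|x 0 j| <= `|x|.
Proof. by rewrite [leRHS]/Num.Def.normr /= mx_normrE; apply/bigmax_geP; right => /=; exists (0, j). Qed.

Lemma row_norm_le n (x : 'rV[R]_n) c : 0 <= c -> (forall j, `|x 0 j| <= c) -> `|x| <= c.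
Proof.
move=> c0 h; rewrite [leLHS]/Num.Def.normr /= mx_normrE; apply/bigmax_leP; split=> //.
by move=> [i j] _ /=; rewrite (ord1 i).
Qed.

Lemma mulmx_norm_le n m (A : 'M[R]_(n, m)) :
  exists2 c : R, 0 < c & forall v : 'rV[R]_n, `|v *m A| <= c * `|v|.
Proof.
exists (1 + \sum_i \sum_j `|A i j|).
  by rewrite ltr_pwDl// sumr_ge0// => i _; rewrite sumr_ge0.
move=> v; apply: row_norm_le => [|j].
  by rewrite mulr_ge0// addr_ge0// sumr_ge0// => i _; rewrite sumr_ge0.
rewrite mxE (le_trans (ler_norm_sum _ _ _))//.
rewrite (@le_trans _ _ (\sum_i `|A i j| * `|v|))//.
  by apply: ler_sum => i _; rewrite normrM mulrC ler_wpM2l// row_entry_norm.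
rewrite -mulr_suml ler_wpM2r// (@le_trans _ _ (\sum_i \sum_j `|A i j|))//; last by rewrite lerDr.
by apply: ler_sum => i _; rewrite (bigD1 j)//= lerDl sumr_ge0.
Qed.

Lemma derive_row_sum n m (f : 'rV[R]_n -> 'rV[R]_m) x v : differentiable f x ->
  'D_v f x = \sum_i v 0 i *: 'D_(delta_mx 0 i) f x.
Proof.
move=> df; rewrite (deriveE _ df) [X in 'd f x X]row_sum_delta linear_sum.
by apply: eq_bigr => i _; rewrite linearZ -(deriveE _ df).
Qed.

(** The transpose of the usual convention, so that the differential is right multiplication on row
    vectors. *)
Definition jac n m (f : 'rV[R]_n -> 'rV[R]_m) (x : 'rV[R]_n) : 'M[R]_(n, m) :=
  \matrix_(i, j) 'D_(delta_mx 0 i) f x 0 j.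

Lemma derive_jac n m (f : 'rV[R]_n -> 'rV[R]_m) x v : differentiable f x ->
  'D_v f x = v *m jac f x.
Proof.
move=> df; rewrite derive_row_sum// mulmx_sum_row; apply: eq_bigr => i _.
by congr (_ *: _); apply/rowP => j; rewrite !mxE.
Qed.

Lemma Cinf_jac n m (U : set 'rV[R]_n) (f : 'rV[R]_n -> 'rV[R]_m) i j : open U ->
  Cinf U f -> Cinf U (fun x => jac f x i j : R^o).
Proof.
move=> oU Cf; apply: (Cinf_eq oU _ (@Cinf_derive_delta _ _ _ _ _ (delta_mx 0 i) j oU Cf)).
by move=> x _; rewrite mxE.
Qed.

Lemma is_derive_line (V W : normedModType R) (g : V -> W) (x d : V) (t : R) :
  differentiable g (x + t *: d) ->
  is_derive (t : R^o) 1 (fun s : R^o => g (x + s *: d)) ('D_d g (x + t *: d)).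
Proof.
move=> dg.
have dl : differentiable (fun s : R^o => x + s *: d) t.
  apply: differentiableD; first exact: differentiable_cst.
  by apply: differentiableZl.
have dc : differentiable (fun s : R^o => g (x + s *: d)) t.
  exact: (differentiable_comp dl dg).
split; first exact: diff_derivable.
rewrite (deriveE _ dc) (diff_comp dl dg) /= (deriveE _ dg); congr ('d g _ _).
rewrite -(deriveE _ dl).
have -> : (fun s : R^o => x + s *: d) = cst x + (fun s : R^o => s *: d).
  by apply/funext.
rewrite deriveD; [|exact: derivable_cst|exact: diff_derivable].
rewrite derive_cst add0r.
have dz : differentiable (fun s : R^o => s *: d) t by apply: differentiableZl.
by rewrite (deriveE _ dz) diffZl// diff_val scale1r.
Qed.

(** Mean value theorem along the segment from [x] to [y], which stays in the ball by convexity. The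
    factor [n] counts the partial derivatives, each coordinate of [y - x] being bounded by its sup
    norm. *)
Lemma lipschitz_partials n (g : 'rV[R]_n -> R^o) (x0 : 'rV[R]_n) (r e : R) :
  (forall x, `|x - x0| <= r -> differentiable g x) ->
  (forall x j, `|x - x0| <= r -> `|'D_(delta_mx 0 j) g x| <= e) ->
  forall x y, `|x - x0| <= r -> `|y - x0| <= r -> `|g y - g x| <= n%:R * e * `|y - x|.
Proof.
move=> dg ge x y xr yr.
have conv t : 0 <= t <= 1 -> `|x + t *: (y - x) - x0| <= r.
  move=> /andP[t0 t1].
  have -> : x + t *: (y - x) - x0 = (1 - t) *: (x - x0) + t *: (y - x0).
    apply/rowP => j; rewrite !mxE; ring.
  rewrite (le_trans (ler_normD _ _))// !normrZ !ger0_norm ?subr_ge0//.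
  have -> : r = (1 - t) * r + t * r by ring.
  by rewrite lerD// ler_wpM2l// subr_ge0.
pose h : R -> R := fun t => g (x + t *: (y - x)).
have hd t : 0 <= t <= 1 -> is_derive (t : R^o) 1 (h : R^o -> R^o) ('D_(y - x) g (x + t *: (y - x))).
  by move=> t01; apply: is_derive_line; apply: dg; exact: conv.
have [||c c01 hc] := @MVT_segment R h (fun t => 'D_(y - x) g (x + t *: (y - x))) 0 1 ler01.
- move=> t; rewrite in_itv/= => /andP[t0 t1]; apply: hd; by rewrite !ltW.
- apply: continuous_in_subspaceT => t; rewrite inE /= in_itv/= => /hd[ht _].
  by apply: (@differentiable_continuous R R^o R^o t h); apply/derivable1_diffP.
move: hc; rewrite /h subr0 mulr1 scale1r scale0r addr0 [x + _]addrC subrK => ->.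
have {}c01 := conv c c01.
have dc := dg _ c01.
rewrite (deriveE _ dc) [X in 'd g _ X]row_sum_delta linear_sum /=.
rewrite (le_trans (ler_norm_sum _ _ _))//.
rewrite (@le_trans _ _ (\sum_(j < n) e * `|y - x|))//; last first.
  by rewrite sumr_const card_ord -mulrA mulr_natl.
apply: ler_sum => j _; rewrite linearZ/= -(deriveE _ dc) normrM mulrC.
by apply: ler_pM => //; [exact: ge|exact: row_entry_norm].
Qed.

End RowNorm.

(** * The inverse function theorem *)

Section InverseFunction.
Context {R : realType}.

Lemma nbhs_closed_norm_ball (V : normedModType R) (x : V) (P : set V) : nbhs x P ->
  exists2 r : R, 0 < r & forall y, `|y - x| <= r -> P y.
Proof.
move=> /nbhs_ballP[r /= r0 hr]; exists (r / 2); first by rewrite divr_gt0.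
move=> y yr; apply: hr; rewrite -ball_normE /= distrC (le_lt_trans yr)//.
by rewrite ltr_pdivrMr// ltr_pMr// ltr1n.
Qed.

Lemma continuous_dist (T : topologicalType) (V : normedModType R) (f : T -> V) (y : V) x :
  {for x, continuous f} -> {for x, continuous (fun z => `|f z - y|)}.
Proof.
move=> fx.
have h : (fun z => f z - y) @ x --> f x - y.
  by apply: (@cvgB _ _ _ (nbhs x) _ f (cst y)); [exact: fx|exact: cvg_cst].
exact: (cvg_norm h).
Qed.

(** The map [f - id] has zero derivative at [x0], so its partial derivatives are small on a small
    ball and the mean value inequality makes it a contraction there. *)
Lemma displacement_half_lipschitz n (U : set 'rV[R]_n) (f : 'rV[R]_n -> 'rV[R]_n) x0 :
  open U -> U x0 -> Cinf U f -> (forall v, 'D_v f x0 = v) ->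
  exists2 r : R, 0 < r & (forall x, `|x - x0| <= r -> U x) /\
    forall x y, `|x - x0| <= r -> `|y - x0| <= r ->
      `|(f y - f x) - (y - x)| <= 2^-1 * `|y - x|.
Proof.
move=> oU Ux0 Cf Df.
pose g (j : 'I_n) (x : 'rV[R]_n) : R^o := f x 0 j - x 0 j.
have Cg j : Cinf U (g j).
  by apply: CinfD => //; [|apply: CinfN => //]; apply: Cinf_entry => //; exact: Cinf_id.
(* Chosen so that [n e <= 1/2]; [n.+1] keeps the denominator nonzero when [n = 0]. *)
pose e : R := (2 * n.+1%:R)^-1.
have e0 : 0 < e by rewrite invr_gt0 mulr_gt0.
have gx0 i j : 'D_(delta_mx 0 i) (g j) x0 = 0.
  have dfx := Cinf_differentiable Cf Ux0.
  have df0 : differentiable (fun x => f x 0 j : R^o) x0 by exact: differentiable_entry.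
  have di0 : differentiable (fun x : 'rV[R]_n => x 0 j : R^o) x0.
    exact: (@differentiable_coord R 1 n x0 0 j).
  rewrite [LHS](@deriveB R _ R^o (fun x => f x 0 j) (fun x => x 0 j)); [|exact: diff_derivable..].
  rewrite -(derive_row_mxE _ 0 _ dfx) Df.
  have -> : 'D_(delta_mx 0 i) (fun x : 'rV[R]_n => x 0 j : R^o) x0 = (delta_mx 0 i : 'rV[R]_n) 0 j.
    have di : differentiable (id : 'rV[R]_n -> 'rV[R]_n) x0 by exact: (@ex_diff _ _ _ _ _ id id).
    by rewrite -(derive_row_mxE _ 0 _ di) derive_id.
  by rewrite subrr.
have near_small : \forall x \near x0, forall i j, `|'D_(delta_mx 0 i) (g j) x| <= e.
  apply: (@filter_forall _ _ _ _ (nbhs_filter x0)) => i.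
  apply: (@filter_forall _ _ _ _ (nbhs_filter x0)) => j.
  have := Cinf_continuous (Cinf_derive (delta_mx 0 i) (Cg j)) Ux0.
  move=> c; have {c} : 'D_(delta_mx 0 i) (g j) @ x0 --> (0 : R^o).
    by rewrite -(gx0 i j); exact: c.
  move=> /cvgrPdist_le/(_ e e0); apply: filterS => x /=; by rewrite sub0r normrN.
have near_U : nbhs x0 U by exact: open_nbhs_nbhs.
have [r r0 hr] := nbhs_closed_norm_ball (filterI near_U near_small).
exists r => //; split=> [x /hr[]//|x y xr yr].
apply: row_norm_le => [|j]; first by rewrite mulr_ge0.
have -> : (f y - f x - (y - x)) 0 j = g j y - g j x.
  by rewrite /g !mxE; ring.
have h := @lipschitz_partials R n (g j) x0 r e _ _ x y xr yr.
rewrite (le_trans (h _ _))//.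
- by move=> z /hr[Uz _]; exact: Cinf_differentiable (Cg j) Uz.
- by move=> z i /hr[_]; exact.
rewrite ler_wpM2r// /e invfM mulrCA ler_piMr//.
by rewrite ler_pdivrMr// mul1r ler_nat.
Qed.

Section LocalInverse.
Context {n : nat} {f : 'rV[R]_n -> 'rV[R]_n} {x0 : 'rV[R]_n} {r : R}.
Hypothesis r0 : 0 < r.
Hypothesis fr : forall x y, `|x - x0| <= r -> `|y - x0| <= r ->
      `|(f y - f x) - (y - x)| <= 2^-1 * `|y - x|.

Lemma half_expanding x y : `|x - x0| <= r -> `|y - x0| <= r ->
  `|y - x| <= 2 * `|f y - f x|.
Proof.
move=> xr yr; have := fr xr yr.
have := ler_normD (f y - f x) (- (f y - f x - (y - x))).
rewrite normrN (_ : _ - (_ - _) = y - x); last by apply/rowP => j; rewrite !mxE; ring.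
move: `|f y - f x| `|y - x| `|_ - (_ - _)| => a b c; lra.
Qed.

(* At a minimizer x of |f - y| the step of length t in direction y - f x would
   decrease |f - y| by a factor 1 - t / 2. *)
Lemma half_expanding_surj y : (forall x, `|x - x0| <= r -> {for x, continuous f}) ->
  `|y - f x0| < r / 4 -> exists2 x, `|x - x0| < r & f x = y.
Proof.
move=> fc yr.
pose K := [set x | `|x - x0| <= r].
have K0 : K x0 by rewrite /K /= subrr normr0 ltW.
have cK : compact K.
  have cl : closed K.
    have -> : K = (fun x => `|x - x0|) @^-1` [set z | z <= r] by [].
    apply: closed_comp => [x _|]; last exact: closed_le.
    by apply: continuous_dist; exact: cvg_id.
  apply: bounded_closed_compact cl.
  exists (`|x0| + r); split; first exact: num_real.
  move=> M hM x Kx; apply: le_trans (ltW hM).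
  rewrite -(subrK x0 x) (le_trans (ler_normD _ _))// addrC lerD2l; exact: Kx.
have [|||x xK xmin] := @EVT_min_rV R n (fun x => `|f x - y|) K.
- by exists x0.
- by [].
- apply: continuous_in_subspaceT => x /set_mem Kx.
  by apply: continuous_dist; exact: fc.
move/set_mem : xK => Kx.
(* The minimizer is strictly inside the ball: [|x - x0| <= 2 |f x - f x0| <= 4 |y - f x0| < r],
   since [x0] competes for the minimum. This is the origin of the radius [r / 4]. *)
have x_lt : `|x - x0| < r.
  have := xmin x0 (mem_set K0).
  have := half_expanding K0 Kx.
  have := ler_normD (f x - y) (y - f x0); rewrite subrKA.
  rewrite (distrC (f x0) y).
  move: yr r0 Kx; rewrite /K /=.
  move: `|x - x0| `|f x - f x0| `|f x - y| `|y - f x0| => a b c d; lra.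
exists x => //; apply/eqP; rewrite -subr_eq0 -normr_eq0; apply/eqP.
pose d := y - f x; rewrite distrC -/d.
apply/eqP; case: (eqVneq `|d| 0) => [//|dn0]; exfalso.
have d0 : 0 < `|d| by rewrite lt_neqAle eq_sym dn0 normr_ge0.
pose t := Num.min 1 ((r - `|x - x0|) / `|d|).
have t0 : 0 < t by rewrite lt_min ltr01 divr_gt0// subr_gt0.
have t1 : t <= 1 by rewrite ge_min lexx.
have td : t * `|d| <= r - `|x - x0|.
  by rewrite -ler_pdivlMr// ge_min lexx orbT.
have Kt : K (x + t *: d).
  rewrite /K /= addrAC (le_trans (ler_normD _ _))// normrZ (ger0_norm (ltW t0)).
  by rewrite -lerBrDl.
have := xmin _ (mem_set Kt).
have := fr Kx Kt; rewrite [x + _]addrC addrK normrZ (ger0_norm (ltW t0)).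
have -> : f (t *: d + x) - y = (f (t *: d + x) - f x - t *: d) + (t - 1) *: d.
  by apply/rowP => j; rewrite /d !mxE; ring.
move=> h1; rewrite leNgt => /negP; apply.
rewrite (le_lt_trans (ler_normD _ _))// normrZ [`|t - 1|]ler0_norm ?subr_le0//.
rewrite (distrC (f x)) -/d.
move: h1 t0 d0; move: `|_ - _ - _| `|d| => a b; nra.
Qed.

End LocalInverse.
End InverseFunction.

Section InverseFunctionTheorem.
Context {R : realType}.

Lemma open_preimage_in (T W : topologicalType) (f : T -> W) (A : set T) (C : set W) :
  open A -> open C -> (forall x, A x -> {for x, continuous f}) ->
  open (A `&` f @^-1` C).
Proof.
move=> oA oC fc; rewrite openE => x [Ax Cfx]; apply: filterI.
  exact: open_nbhs_nbhs.
by apply: (fc x Ax); exact: open_nbhs_nbhs.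
Qed.

Lemma mulmxr_continuous m n (A : 'M[R]_(m, n)) :
  continuous (mulmxr A : 'rV[R]_m -> 'rV[R]_n).
Proof.
have [c c0 hc] := mulmx_norm_le A.
apply: bounded_linear_continuous; apply/linear_boundedP.
by near=> k => v; rewrite (le_trans (hc v))// ler_wpM2r.
Unshelve. all: by end_near. Qed.

Lemma derive_mulmxr m n (V : normedModType R) (f : V -> 'rV[R]_m) (A : 'M[R]_(m, n)) x v :
  differentiable f x -> 'D_v (fun y => f y *m A) x = 'D_v f x *m A.
Proof.
move=> df; have Lc := @mulmxr_continuous m n A.
have dL := linear_differentiable (f x) Lc.
have dc := differentiable_comp df dL.
rewrite (deriveE _ (dc : differentiable (fun y => f y *m A) x)) (diff_comp df dL).
by rewrite (deriveE _ df) /= diff_lin.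
Qed.

Lemma Cinf_mulmxr m n (V : normedModType R) (U : set V) (f : V -> 'rV[R]_m) (A : 'M[R]_(m, n)) :
  open U -> Cinf U f -> Cinf U (fun x => f x *m A).
Proof.
by move=> oU Cf k; apply: (Ck_on_open_linear (@mulmxr_continuous m n A)).
Qed.

(** Along a vector [v] of the kernel of the Jacobian, the increment of [f] at [t v] would be [o(t)],
    against the expansion property. *)
Lemma half_expanding_jac_unit n (f : 'rV[R]_n -> 'rV[R]_n) (x : 'rV[R]_n) :
  differentiable f x ->
  (\forall y \near x, `|y - x| <= 2 * `|f y - f x|) -> jac f x \in unitmx.
Proof.
move=> df hx; rewrite -row_free_unit -kermx_eq0; apply/eqP/row_matrixP => i.
rewrite row0; set v := row i _.
have vA : v *m jac f x = 0 by apply/sub_kermxP; exact: row_sub.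
apply/eqP; rewrite -normr_eq0; case: (eqVneq `|v| 0) => [//|vn0]; exfalso.
have v0 : 0 < `|v| by rewrite lt_neqAle eq_sym vn0 normr_ge0.
have hx' : \forall h \near (0 : 'rV[R]_n), `|h| <= 2 * `|f (h + x) - f x|.
  move: hx; rewrite [X in X -> _](near_shift 0 x); apply: filterS => h /=.
  by rewrite subr0 addrK.
have ha := differentiable_approx df (_ : 0 < 4^-1 :> R).
have {ha} ha := ha ltac:(by rewrite invr_gt0).
have [r r0 hr] := nbhs_closed_norm_ball (filterI hx' ha).
pose t := r / `|v|.
have t0 : 0 < t by rewrite divr_gt0.
have ntv : `|t *: v| = r by rewrite normrZ (gtr0_norm t0) divfK.
have := hr (t *: v); rewrite subr0 ntv lexx => /(_ isT)[] /=.
rewrite -(deriveE _ df) derive_jac// -scalemxAl vA scaler0 subr0 ntv.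
move: r0; move: `|_ - _| => a; lra.
Qed.

(** With [h = g (k + y) - g y] one has [k = f (g y + h) - f (g y) = h J + o(h)]. The Lipschitz bound
    turns [o(h)] into [o(k)], and multiplying by [J^-1] gives the derivative of [g]. *)
Lemma inverse_differentiable n (f g : 'rV[R]_n -> 'rV[R]_n) (C : set 'rV[R]_n) y :
  open C -> C y -> (forall z, C z -> f (g z) = z) ->
  differentiable f (g y) ->
  jac f (g y) \in unitmx ->
  (forall z, C z -> `|g z - g y| <= 2 * `|z - y|) ->
  differentiable g y /\ forall v, 'D_v g y = v *m invmx (jac f (g y)).
Proof.
move=> oC Cy fg df uJ gL.
set J := jac f (g y); pose x := g y.
pose L : {linear 'rV[R]_n -> 'rV[R]_n} := mulmxr (invmx J).
have [c c0 hc] := mulmx_norm_le (invmx J).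
have Lc : continuous L by exact: mulmxr_continuous.
have approx e : 0 < e -> \forall k \near (0 : 'rV[R]_n), `|g (k + y) - g y - L k| <= e * `|k|.
  move=> e0; pose e' := e / (2 * c).
  have e'0 : 0 < e' by rewrite divr_gt0// mulr_gt0.
  have [r r0 hr] := nbhs_closed_norm_ball (differentiable_approx df e'0).
  have nC : \forall k \near (0 : 'rV[R]_n), C (k + y).
    have : \forall k \near y, C k by exact: open_nbhs_nbhs.
    by rewrite [X in X -> _](near_shift 0 y); apply: filterS => k /=; rewrite subr0.
  have nr : \forall k \near (0 : 'rV[R]_n), `|k| <= r / 2.
    apply/nbhs_ballP; exists (r / 2); first by rewrite /= divr_gt0.
    by move=> k; rewrite -ball_normE /= sub0r normrN => /ltW.
  near=> k.
  have Ck : C (k + y) by near: k.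
  have kr : `|k| <= r / 2 by near: k.
  pose h := g (k + y) - g y.
  have hk : `|h| <= 2 * `|k| by have := gL _ Ck; rewrite addrK.
  have hr' : `|h - 0| <= r.
    by rewrite subr0 (le_trans hk)// mulrC -ler_pdivlMr.
  have := hr h hr'; rewrite -(deriveE _ df) derive_jac// -/J.
  have -> : f (h + g y) - f (g y) = k.
    by rewrite /h subrK !fg// addrK.
  move=> hh.
  have -> : g (k + y) - g y - L k = - ((k - h *m J) *m invmx J).
    by rewrite /L/= mulmxBl opprB -mulmxA mulmxV// mulmx1.
  rewrite normrN (le_trans (hc _))// (@le_trans _ _ (c * (e' * `|h|)))//.
    by rewrite ler_wpM2l// ltW.
  rewrite (@le_trans _ _ (c * (e' * (2 * `|k|))))//.
    by rewrite ler_wpM2l ?(ltW c0)// ler_wpM2l// ltW.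
  rewrite /e' le_eqVlt; apply/orP; left; apply/eqP; field.
  by rewrite gt_eqF.
have dg : differentiable g y by exact: differentiable_eps Lc approx.
split=> // v; rewrite (deriveE _ dg).
have -> : 'd g y = L :> (_ -> _); last by [].
apply: diff_unique => //; apply/eqaddoP => e /approx; apply: filterS => k.
by rewrite /= !fctE opprD addrA.
Unshelve. all: by end_near. Qed.

(** Bootstrap: the derivative of [g] is the inverse Jacobian of [f] composed with [g], hence as
    regular as [g] is. *)
Lemma Cinf_inverse n (f g : 'rV[R]_n -> 'rV[R]_n) (B C : set 'rV[R]_n) :
  open B -> open C -> Cinf B f ->
  (forall y, C y -> B (g y)) ->
  (forall x, B x -> jac f x \in unitmx) ->
  (forall y, C y -> differentiable g y) ->
  (forall y v, C y -> 'D_v g y = v *m invmx (jac f (g y))) ->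
  Cinf C g.
Proof.
move=> oB oC Cf gB uJ dg Dg; elim=> [|k IH].
  by move=> y Cy; apply: differentiable_continuous; exact: dg.
split=> // v.
have C1 : Cinf B (fun x => v *m invmx (jac f x)).
  apply/(Cinf_row _ oB) => j; apply: Cinf_mulmx => // [i l|i l]; first exact: Cinf_cst.
  by apply: Cinf_invmx => // i' l'; exact: Cinf_jac.
apply: (Ck_on_open_eq oC) (Ck_on_open_comp_row oC oB gB IH (C1 k)) => y Cy.
by rewrite /= Dg.
Qed.

Theorem inverse_function_id n (U : set 'rV[R]_n) (f : 'rV[R]_n -> 'rV[R]_n) x0 :
  open U -> U x0 -> Cinf U f -> (forall v, 'D_v f x0 = v) ->
  exists (B C : set 'rV[R]_n) (g : 'rV[R]_n -> 'rV[R]_n),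
    [/\ [/\ open B, open C, B x0 & B `<=` U],
        forall x, B x -> C (f x) /\ g (f x) = x,
        forall y, C y -> B (g y) /\ f (g y) = y & Cinf C g].
Proof.
move=> oU Ux0 Cf Df.
have [r r0 [rU fr]] := displacement_half_lipschitz oU Ux0 Cf Df.
have fc x : `|x - x0| <= r -> {for x, continuous f}.
  by move=> /rU; exact: Cinf_continuous.
pose C := [set y | `|y - f x0| < r / 4].
pose B0 := [set x | `|x - x0| < r].
pose B := B0 `&` f @^-1` C.
have B0ball : B0 = ball x0 r.
  by apply/seteqP; split=> x; rewrite -ball_normE /B0 /= distrC.
have oC : open C.
  have -> : C = ball (f x0) (r / 4).
    by apply/seteqP; split=> x; rewrite -ball_normE /C /= distrC.
  exact: ball_open.
have oB0 : open B0 by rewrite B0ball; exact: ball_open.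
have oB : open B.
  by apply: open_preimage_in => // x /ltW; exact: fc.
have Br x : B x -> `|x - x0| <= r by case=> /ltW.
have Bx0 : B x0.
  by split; rewrite /B0 /C /= subrr normr0// divr_gt0.
have sol y : C y -> exists x, B x /\ f x = y.
  by move=> Cy; have [x xr fx] := half_expanding_surj r0 fr fc Cy; exists x; split=> //; split=> //; rewrite /= fx.
(* A preimage chosen in [B]; outside [C] the value [x0] is a mere default. *)
pose g y := if pselect (C y) is left Cy then projT1 (cid (sol y Cy)) else x0.
have gP y : C y -> B (g y) /\ f (g y) = y.
  by rewrite /g; case: pselect => // Cy _; exact: (projT2 (cid (sol y Cy))).
have exp x y : B x -> B y -> `|y - x| <= 2 * `|f y - f x|.
  by move=> /Br xr /Br yr; exact: half_expanding fr _ _ xr yr.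
have gf x : B x -> g (f x) = x.
  move=> Bx; have [Bg fg] := gP (f x) Bx.2.
  by have := exp _ _ Bx Bg; rewrite fg subrr normr0 mulr0 normr_le0 subr_eq0 => /eqP.
have df x : B x -> differentiable f x by move=> /Br/rU; exact: Cinf_differentiable.
have uJ x : B x -> jac f x \in unitmx.
  move=> Bx; apply: half_expanding_jac_unit; first exact: df.
  near=> y; apply: exp => //; near: y; exact: open_nbhs_nbhs.
have gL y z : C y -> C z -> `|g z - g y| <= 2 * `|z - y|.
  by move=> /gP[By fy] /gP[Bz fz]; have := exp _ _ By Bz; rewrite fz fy.
have dg y : C y -> differentiable g y /\ forall v, 'D_v g y = v *m invmx (jac f (g y)).
  move=> Cy; have [By fy] := gP y Cy.
  apply: (inverse_differentiable oC) => //.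
  - by move=> z /gP[].
  - exact: df.
  - exact: uJ.
  - by move=> z; exact: gL.
exists B, C, g; split=> //.
- by split=> // x /Br; exact: rU.
- by move=> x Bx; split; [exact: Bx.2|exact: gf].
apply: (Cinf_inverse oB oC) uJ _ _ => //.
- by apply: Cinf_sub Cf => x /Br; exact: rU.
- by move=> y /gP[].
- by move=> y /dg[].
- by move=> y v /dg[_]; exact.
Unshelve. all: by end_near. Qed.

(** Composing [f] with the inverse of its Jacobian at [x0] reduces to the case where the derivative
    is the identity. *)
Theorem inverse_function n (U : set 'rV[R]_n) (f : 'rV[R]_n -> 'rV[R]_n) x0 :
  open U -> U x0 -> Cinf U f -> jac f x0 \in unitmx ->
  exists (B C : set 'rV[R]_n) (g : 'rV[R]_n -> 'rV[R]_n),
    [/\ [/\ open B, open C, B x0 & B `<=` U],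
        forall x, B x -> C (f x) /\ g (f x) = x,
        forall y, C y -> B (g y) /\ f (g y) = y & Cinf C g].
Proof.
move=> oU Ux0 Cf uJ; set J := jac f x0.
pose F x := f x *m invmx J.
have CF : Cinf U F by exact: Cinf_mulmxr.
have DF v : 'D_v F x0 = v.
  have df := Cinf_differentiable Cf Ux0.
  by rewrite derive_mulmxr// derive_jac// mulmxK.
have [B [C [g [[oB oC Bx0 BU] h1 h2 Cg]]]] := inverse_function_id oU Ux0 CF DF.
pose C' := [set y | C (y *m invmx J)].
have Cl : Cinf setT (fun y : 'rV[R]_n => y *m invmx J).
  by apply: Cinf_mulmxr; [exact: openT|exact: Cinf_id].
have oC' : open C'.
  have -> : C' = (mulmxr (invmx J) : 'rV[R]_n -> 'rV[R]_n) @^-1` C by [].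
  by apply: open_comp => // x _; exact: mulmxr_continuous.
exists B, C', (fun y => g (y *m invmx J)); split=> // [y|].
  move=> /h2[Bg Fg]; split=> //.
  by apply: (can_inj (mulmxK (_ : invmx J \in unitmx))); rewrite ?unitmx_inv.
by apply: (@Cinf_comp_row _ _ _ _ C' C) => //; exact: Cinf_sub Cl.
Qed.

End InverseFunctionTheorem.

(** * Smooth Cholesky decomposition *)

Section Cholesky.
Context {R : realType}.

Definition posdef n (A : 'M[R]_n) := forall v : 'rV[R]_n, v != 0 -> 0 < (v *m A *m v^T) 0 0.

Lemma posdef_unitmx n (A : 'M[R]_n) : posdef A -> A \in unitmx.
Proof.
move=> pA; rewrite -row_free_unit -kermx_eq0; apply/eqP/row_matrixP => i.
rewrite row0; apply/eqP; apply: contraT => /pA.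
have -> : row i (kermx A) *m A = 0 by apply/sub_kermxP; exact: row_sub.
by rewrite mul0mx mxE ltxx.
Qed.

Lemma Cinf_block_mx (V : normedModType R) (U : set V) m1 m2 n1 n2
    (A : V -> 'M[R]_(m1, n1)) (B : V -> 'M[R]_(m1, n2))
    (C : V -> 'M[R]_(m2, n1)) (D : V -> 'M[R]_(m2, n2)) :
  (forall i j, Cinf U (fun x => A x i j : R^o)) ->
  (forall i j, Cinf U (fun x => B x i j : R^o)) ->
  (forall i j, Cinf U (fun x => C x i j : R^o)) ->
  (forall i j, Cinf U (fun x => D x i j : R^o)) ->
  forall i j, Cinf U (fun x => block_mx (A x) (B x) (C x) (D x) i j : R^o).
Proof.
move=> cA cB cC cD i j; case: (split_ordP i) => i' ->; case: (split_ordP j) => j' ->.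
- by apply: Cinf_ext (cA i' j') => x; rewrite block_mxEul.
- by apply: Cinf_ext (cB i' j') => x; rewrite block_mxEur.
- by apply: Cinf_ext (cC i' j') => x; rewrite block_mxEdl.
- by apply: Cinf_ext (cD i' j') => x; rewrite block_mxEdr.
Qed.

Lemma mulmx_tr_ge0 n m (w : 'rV[R]_n) (P : 'M[R]_(n, m)) : 0 <= (w *m (P *m P^T) *m w^T) 0 0.
Proof.
rewrite mulmxA -mulmxA -trmx_mul mxE sumr_ge0// => k _.
by rewrite [X in _ * X]mxE -expr2 sqr_ge0.
Qed.

(** Induction on the size, splitting off the first row and column. For [S = [[a, b], [b^T, C]]] the
    factor is [[[sqrt a, 0], [b^T / sqrt a, P']]], where [P'] factors the Schur complement
    [C - b^T b / a]; the neighbourhood is shrunk to keep [a > 0]. *)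
Theorem smooth_cholesky N n (U : set 'rV[R]_N) (S : 'rV[R]_N -> 'M[R]_n) x0 :
  open U -> U x0 -> (forall i j, Cinf U (fun x => S x i j : R^o)) ->
  (forall x, U x -> (S x)^T = S x) -> posdef (S x0) ->
  exists (U' : set 'rV[R]_N) (P : 'rV[R]_N -> 'M[R]_n),
    [/\ [/\ open U', U' x0 & U' `<=` U],
        forall i j, Cinf U' (fun x => P x i j : R^o) &
        forall x, U' x -> S x = P x *m (P x)^T].
Proof.
elim: n U S => [|n IH] U S oU Ux0 CS symS pS.
  exists U, (fun=> 0); split; [by split|by case|move=> x _].
  by rewrite [LHS]flatmx0 [RHS]flatmx0.
pose a x : R := (S x : 'M[R]_(1 + n)) 0 0.
pose b x : 'rV[R]_n := ursubmx (S x : 'M[R]_(1 + n)).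
pose C x : 'M[R]_n := drsubmx (S x : 'M[R]_(1 + n)).
have SE x : U x -> S x = block_mx (a x)%:M (b x) (b x)^T (C x) :> 'M[R]_(1 + n).
  move=> Ux; rewrite -[LHS](@submxK _ 1 n 1 n); congr block_mx.
    by apply/rowP => i; rewrite (ord1 i) !mxE/= mulr1n /a; congr (S x _ _); exact: val_inj.
  by rewrite /b -[in LHS]symS// trmx_ursub.
have a0 : 0 < a x0.
  have := pS (delta_mx 0 0); rewrite -rowE trmx_delta -colE !mxE; apply.
  by apply/eqP => /rowP/(_ 0)/eqP; rewrite !mxE !eqxx oner_eq0.
pose U1 := U `&` a @^-1` [set t | 0 < t].
have oU1 : open U1.
  apply: open_preimage_in => // x Ux.
  exact: Cinf_continuous (CS _ _) Ux.
have U1U : U1 `<=` U by move=> x [].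
have Ca : Cinf U1 (a : _ -> R^o) by exact: Cinf_sub (CS _ _).
have an0 x : U1 x -> a x != 0 by case=> _ /= h; rewrite gt_eqF.
have Cb i j : Cinf U1 (fun x => b x i j : R^o).
  by apply: Cinf_ext (Cinf_sub U1U (CS (lshift n i) (rshift 1 j))) => x; rewrite !mxE.
have CC i j : Cinf U1 (fun x => C x i j : R^o).
  by apply: Cinf_ext (Cinf_sub U1U (CS (rshift 1 i) (rshift 1 j))) => x; rewrite !mxE.
pose S' x : 'M[R]_n := C x - (a x)^-1 *: ((b x)^T *m b x).
have symS' x : U1 x -> (S' x)^T = S' x.
  move=> [Ux _]; rewrite /S' linearB linearZ /= trmx_mul trmxK; congr (_ - _).
  by rewrite /C trmx_drsub symS.
have CS' i j : Cinf U1 (fun x => S' x i j : R^o).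
  have h : Cinf U1 (fun x => C x i j + - ((a x)^-1 * (b x 0 i * b x 0 j)) : R^o).
    by apply: CinfD => //; apply: CinfN => //; apply: CinfM => //; [exact: CinfV|exact: CinfM].
  by apply: (Cinf_eq oU1 _ h) => x _; rewrite !mxE big_ord1 !mxE.
have pS' : posdef (S' x0).
  (* Completing the square: this [t] annihilates the first component of [(t, w) S], so the form of
     [S] at [(t, w)] is that of the Schur complement at [w]. *)
  move=> w wn0; pose t : 'M[R]_1 := - ((a x0)^-1 *: (w *m (b x0)^T)).
  have vn0 : row_mx t w != 0 :> 'rV[R]_(1 + n).
    by apply: contra wn0 => /eqP/(congr1 (@rsubmx _ 1 1 n)); rewrite row_mxKr linear0 => ->.
  have := pS _ vn0; rewrite SE// (@mul_row_block _ 1 1 n 1 n) (@tr_row_mx _ 1 1 n) (@mul_row_col _ 1 1 n 1).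
  have -> : t *m (a x0)%:M + w *m (b x0)^T = 0.
    by rewrite mul_mx_scalar /t scalerN scalerA divff ?gt_eqF// scale1r addNr.
  rewrite mul0mx add0r; congr (0 < _); congr (fun_of_matrix _ 0 0); congr (_ *m _).
  by rewrite /t /S' mulmxBr -scalemxAr mulmxA mulNmx -scalemxAl addrC.
have [U' [P' [[oU' U'x0 U'U1] CP' P'E]]] := IH U1 S' oU1 (conj Ux0 a0) CS' symS' pS'.
have U'U : U' `<=` U by move=> x /U'U1/U1U.
have sa x : U' x -> 0 < Num.sqrt (a x) by move=> /U'U1[_ /=]; rewrite sqrtr_gt0.
have Cs : Cinf U' (fun x => Num.sqrt (a x) : R^o).
  apply: Cinf_sqrt => // [x /U'U1[]//|]; exact: Cinf_sub U'U1 Ca.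
exists U', (fun x => block_mx (Num.sqrt (a x))%:M 0 ((Num.sqrt (a x))^-1 *: (b x)^T) (P' x) : 'M[R]_(1 + n)).
split=> // [|x U'x].
  apply: (@Cinf_block_mx _ U' 1 n 1 n (fun x => (Num.sqrt (a x))%:M) (fun=> 0)
    (fun x => (Num.sqrt (a x))^-1 *: (b x)^T) P') => // i j.
  - apply: (Cinf_eq oU' _ Cs) => x _; by rewrite !ord1 !mxE mulr1n.
  - by apply: (Cinf_eq oU' _ (Cinf_cst U' (0 : R^o))) => x _; rewrite mxE.
  - have h : Cinf U' (fun x => (Num.sqrt (a x))^-1 * b x j i : R^o).
      apply: CinfM => //; last exact: Cinf_sub U'U1 (Cb _ _).
      by apply: CinfV => // x /sa; exact: lt0r_neq0.
    by apply: (Cinf_eq oU' _ h) => x _; rewrite !mxE.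
have s0 := sa x U'x; have sn0 := lt0r_neq0 s0.
have ss : Num.sqrt (a x) * Num.sqrt (a x) = a x.
  by rewrite -expr2 sqr_sqrtr// ltW//; have [_] := U'U1 x U'x.
rewrite [LHS](SE _ (U'U _ U'x)) (@tr_block_mx _ 1 n 1 n) (@mulmx_block _ 1 n 1 n 1 n).
rewrite !trmx0 !mul0mx !mulmx0 !addr0 tr_scalar_mx linearZ /= trmxK.
congr (@block_mx _ 1 n 1 n _ _ _ _).
- by rewrite -scalar_mxM ss.
- by rewrite mul_scalar_mx scalerA divff// scale1r.
- by rewrite mul_mx_scalar scalerA divff// scale1r.
- rewrite -P'E// /S' -scalemxAl -scalemxAr scalerA -invfM ss addrC subrK //.
Qed.

End Cholesky.

(** * Homogeneous extensions and their gradients *)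

Section Euclidean.
Context {R : realType}.

Section Dotp.
Context {n : nat}.
Implicit Types x y z : 'rV[R]_n.

Lemma dotpE x y : dotp x y = (x *m y^T) 0 0.
Proof. by rewrite mxE; apply: eq_bigr => i _; rewrite mxE. Qed.

Lemma dotpC x y : dotp x y = dotp y x.
Proof. by apply: eq_bigr => i _; rewrite mulrC. Qed.

Lemma dotpDl x y z : dotp (x + y) z = dotp x z + dotp y z.
Proof. by rewrite /dotp -big_split; apply: eq_bigr => i _; rewrite mxE mulrDl. Qed.

Lemma dotpZl a x z : dotp (a *: x) z = a * dotp x z.
Proof. by rewrite /dotp mulr_sumr; apply: eq_bigr => i _; rewrite mxE mulrA. Qed.

Lemma dotpNl x z : dotp (- x) z = - dotp x z.
Proof. by rewrite -scaleN1r dotpZl mulN1r. Qed.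

Lemma dotpDr z x y : dotp z (x + y) = dotp z x + dotp z y.
Proof. by rewrite !(dotpC z) dotpDl. Qed.

Lemma dotpZr a x z : dotp x (a *: z) = a * dotp x z.
Proof. by rewrite !(dotpC x) dotpZl. Qed.

Lemma dotpNr x z : dotp x (- z) = - dotp x z.
Proof. by rewrite !(dotpC x) dotpNl. Qed.

Lemma dotp_ge0 x : 0 <= dotp x x.
Proof. by rewrite sumr_ge0// => i _; rewrite -expr2 sqr_ge0. Qed.

Lemma dotp_eq0 x : (dotp x x == 0) = (x == 0).
Proof.
apply/eqP/eqP => [|->]; last by rewrite dotpE mul0mx mxE.
move/eqP; rewrite psumr_eq0 => [/allP h|i _]; last by rewrite -expr2 sqr_ge0.
apply/rowP => i; rewrite mxE; apply/eqP.
by have := h i (mem_index_enum i); rewrite /= -expr2 sqrf_eq0.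
Qed.

Lemma dotp_gt0 x : x != 0 -> 0 < dotp x x.
Proof. by move=> x0; rewrite lt_neqAle dotp_ge0 eq_sym dotp_eq0 x0. Qed.

Lemma dotp_inj x y : (forall z, dotp x z = dotp y z) -> x = y.
Proof.
move=> h; apply/eqP; rewrite -subr_eq0 -dotp_eq0 dotpDl dotpNl h subrr //.
Qed.

Lemma enorm_sqr x : enorm x ^+ 2 = dotp x x.
Proof. by rewrite sqr_sqrtr// dotp_ge0. Qed.

Lemma enorm_gt0 x : x != 0 -> 0 < enorm x.
Proof. by move=> x0; rewrite sqrtr_gt0 dotp_gt0. Qed.

Lemma enormZ a x : 0 < a -> enorm (a *: x) = a * enorm x.
Proof.
move=> a0; rewrite /enorm dotpZl dotpZr mulrA -expr2 sqrtrM ?sqr_ge0//.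
by rewrite sqrtr_sqr gtr0_norm.
Qed.

Lemma enormN x : enorm (- x) = enorm x.
Proof. by rewrite /enorm dotpNl dotpNr opprK. Qed.

Lemma dotp_entry_le x i : `|x 0 i| <= enorm x.
Proof.
rewrite -sqrtr_sqr ler_sqrt ?dotp_ge0//.
by rewrite /dotp (bigD1 i)//= expr2 lerDl sumr_ge0// => j _; rewrite -expr2 sqr_ge0.
Qed.

Lemma norm_le_enorm x : `|x| <= enorm x.
Proof. by apply: row_norm_le => [|j]; [exact: sqrtr_ge0|exact: dotp_entry_le]. Qed.

Lemma Cinf_dotp (V : normedModType R) (U : set V) (f g : V -> 'rV[R]_n) : open U ->
  Cinf U f -> Cinf U g -> Cinf U (fun t => dotp (f t) (g t) : R^o).
Proof.
move=> oU Cf Cg; apply: Cinf_sum => // i _; apply: CinfM => //; exact: Cinf_entry.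
Qed.

Lemma dotp_continuous x : continuous (fun y => dotp y x : R^o).
Proof.
move=> y; apply: (@Cinf_continuous _ _ _ setT) => //.
by apply: Cinf_dotp; [exact: openT|exact: Cinf_id|exact: Cinf_cst].
Qed.

Lemma open_nonzero : open [set x : 'rV[R]_n | x != 0].
Proof.
have -> : [set x : 'rV[R]_n | x != 0] = ~` [set 0].
  by apply/seteqP; split=> x /= /eqP.
apply: closed_openC; apply: accessible_closed_set1; apply: hausdorff_accessible.
exact: norm_hausdorff.
Qed.

Lemma Cinf_enorm : Cinf [set x : 'rV[R]_n | x != 0] (fun x => enorm x : R^o).
Proof.
have o := open_nonzero.
apply: Cinf_sqrt => // [x|]; first exact: dotp_gt0.
by apply: Cinf_dotp => //; exact: Cinf_id.
Qed.

Definition unitv x := (enorm x)^-1 *: x.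

Lemma Cinf_unitv : Cinf [set x : 'rV[R]_n | x != 0] unitv.
Proof.
have o := open_nonzero; apply/(Cinf_row _ o) => j.
have h : Cinf [set x : 'rV[R]_n | x != 0] (fun x => (enorm x)^-1 * x 0 j : R^o).
  apply: CinfM => //; last exact: Cinf_coord.
  apply: CinfV => // [x|]; last exact: Cinf_enorm.
  by move=> x0; rewrite gt_eqF// enorm_gt0.
by apply: Cinf_ext h => x; rewrite mxE.
Qed.

Lemma enorm_unitv x : x != 0 -> enorm (unitv x) = 1.
Proof.
by move=> /enorm_gt0 x0; rewrite enormZ ?invr_gt0// mulVf// gt_eqF.
Qed.

Lemma unitvZ a x : 0 < a -> unitv (a *: x) = unitv x.
Proof.
move=> a0; rewrite /unitv enormZ// scalerA invfM mulrAC mulVf ?mul1r//.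
by rewrite gt_eqF.
Qed.

End Dotp.

Section Homog.
Context {n : nat}.
Implicit Types x : 'rV[R]_n.+1.
Implicit Types g : 'rV[R]_n.+1 -> R.

Lemma sphere_neq0 x : sphere x -> x != 0.
Proof.
rewrite /sphere /= => x1; apply/eqP => x0; move: x1.
by rewrite x0 /enorm dotpE mul0mx mxE sqrtr0 => /eqP; rewrite eq_sym oner_eq0.
Qed.

Lemma sphere_dotp x : sphere x -> dotp x x = 1.
Proof. by rewrite /sphere /= => x1; rewrite -enorm_sqr x1 expr1n. Qed.

Lemma sphereN x : sphere x -> sphere (- x).
Proof. by rewrite /sphere /= enormN. Qed.

Lemma unitv_sphere x : x != 0 -> sphere (unitv x).
Proof. exact: enorm_unitv. Qed.

Lemma unitv_id x : sphere x -> unitv x = x.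
Proof. by rewrite /sphere /unitv /= => ->; rewrite invr1 scale1r. Qed.

Definition homog g x : R := enorm x * g (unitv x).

Lemma homog_sphere g x : sphere x -> homog g x = g x.
Proof. by move=> x1; rewrite /homog unitv_id// (x1 : enorm x = 1) mul1r. Qed.

Lemma homogZ g a x : 0 < a -> homog g (a *: x) = a * homog g x.
Proof. by move=> a0; rewrite /homog unitvZ// enormZ// mulrA. Qed.

Lemma homog_gt0 g x : (forall y, sphere y -> 0 < g y) -> x != 0 -> 0 < homog g x.
Proof. by move=> g0 x0; rewrite mulr_gt0 ?enorm_gt0// g0//; exact: unitv_sphere. Qed.

(** A map smooth on a mere subset only has local smooth extensions [F]. Precomposed with a smooth
    [u] into that subset it becomes smooth in the ambient sense, as locally [f \o u = F \o u]. *)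
Lemma smooth_on_comp (V : normedModType R) m (U : set V) (A : set 'rV[R]_m)
    (f : 'rV[R]_m -> R^o) (u : V -> 'rV[R]_m) :
  open U -> smooth_on A f -> Cinf U u -> (forall t, U t -> A (u t)) -> Cinf U (f \o u).
Proof.
move=> oU sf Cu uA; apply: Cinf_cover => x Ux.
have [W [F [oW Wux CF fF]]] := sf _ (uA x Ux).
have oU' : open (U `&` u @^-1` W).
  by apply: open_preimage_in => // y; exact: Cinf_continuous.
exists (U `&` u @^-1` W) => //.
apply: (Cinf_eq oU' _ (Cinf_comp oU' _ (Cinf_sub _ Cu) (CF : Cinf W F))) => // y [Uy Wy] //=.
by rewrite fF//; exact: uA.
Qed.

Lemma smooth_on_comp_row (V : normedModType R) m p (U : set V) (A : set 'rV[R]_m)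
    (f : 'rV[R]_m -> 'rV[R]_p) (u : V -> 'rV[R]_m) :
  open U -> smooth_on A f -> Cinf U u -> (forall t, U t -> A (u t)) -> Cinf U (f \o u).
Proof.
move=> oU sf Cu uA; apply: Cinf_cover => x Ux.
have [W [F [oW Wux CF fF]]] := sf _ (uA x Ux).
have oU' : open (U `&` u @^-1` W).
  by apply: open_preimage_in => // y; exact: Cinf_continuous.
exists (U `&` u @^-1` W) => //.
apply: (Cinf_eq oU' _ (Cinf_comp_row oU' oW _ (Cinf_sub _ Cu) (CF : Cinf W F))) => // y [Uy Wy] //=.
by rewrite fF//; exact: uA.
Qed.

Lemma Cinf_homog g : smooth_on (@sphere R n) (g : _ -> R^o) ->
  Cinf [set x | x != 0] (homog g : _ -> R^o).
Proof.
move=> sg; have o := @open_nonzero n.+1; apply: CinfM => //; first exact: Cinf_enorm.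
by apply: (smooth_on_comp o sg Cinf_unitv) => x; exact: unitv_sphere.
Qed.

Definition grad g x : 'rV[R]_n.+1 := \row_j ('D_(delta_mx 0 j) (homog g : _ -> R^o) x).

Lemma derive_grad g x v : differentiable (homog g : _ -> R^o) x ->
  'D_v (homog g : _ -> R^o) x = dotp (grad g x) v.
Proof.
move=> dg; rewrite (deriveE _ dg) [X in 'd _ _ X]row_sum_delta linear_sum /=.
apply: eq_bigr => j _; rewrite linearZ /= -(deriveE _ dg) mxE; exact: mulrC.
Qed.

Lemma Cinf_grad g : smooth_on (@sphere R n) (g : _ -> R^o) ->
  Cinf [set x | x != 0] (grad g).
Proof.
move=> sg; have o := @open_nonzero n.+1; apply/(Cinf_row _ o) => j.
by apply: Cinf_ext (Cinf_derive (delta_mx 0 j) (Cinf_homog sg)) => x; rewrite mxE.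
Qed.

Lemma homog_differentiable g x : smooth_on (@sphere R n) (g : _ -> R^o) -> x != 0 ->
  differentiable (homog g : _ -> R^o) x.
Proof. by move=> sg x0; apply: Cinf_differentiable (Cinf_homog sg) _. Qed.

(** Euler's identity in degree one: differentiate [G ((1 + s) x) = (1 + s) G x] at [s = 0]. *)
Lemma grad_euler g x : smooth_on (@sphere R n) (g : _ -> R^o) -> x != 0 ->
  dotp (grad g x) x = homog g x.
Proof.
move=> sg x0; have dg := homog_differentiable sg x0.
rewrite -derive_grad//.
have dg0 : differentiable (homog g : _ -> R^o) (x + (0 : R) *: x) by rewrite scale0r addr0.
have [_] := is_derive_line dg0; rewrite scale0r addr0 => <-.
pose h : R^o -> R^o := cst (homog g x) + (homog g x \*: id).
have -> : 'D_1 (fun s : R^o => homog g (x + s *: x) : R^o) (0 : R^o) = 'D_1 h (0 : R^o).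
  apply: near_eq_derive; near=> s.
  rewrite -[X in X + _]scale1r -scalerDl homogZ; first by rewrite /h !fctE mulrDl mul1r mulrC.
  rewrite -ltrBlDl sub0r; near: s; exact: lt_nbhsr.
rewrite /h deriveD//.
rewrite derive_cst add0r deriveZ// derive_id; exact: mulr1.
Unshelve. all: by end_near. Qed.

End Homog.
End Euclidean.

(** * Convex integrands and dual pairs *)

Section ConvexIntegrand.
Context {R : realType} {n : nat}.
Implicit Types (g d : 'rV[R]_n.+1 -> R) (x y theta eta : 'rV[R]_n.+1).

Lemma inv_graphP g y : (forall x, sphere x -> 0 < g x) ->
  (@inversion R n.+1 @` graph g) y <->
  exists2 theta, sphere theta & y = - ((g theta)^-1 *: theta).
Proof.
move=> g0.
have E theta : sphere theta -> inversion (g theta *: theta) = - ((g theta)^-1 *: theta).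
  move=> s1; rewrite /inversion enormZ ?g0// (s1 : enorm theta = 1) mulr1 scalerN.
  by rewrite !scalerA divfK// gt_eqF// g0.
split=> [[_ [theta s1 <-] <-]|[theta s1 ->]]; first by exists theta => //; exact: E.
by exists (g theta *: theta); [exists theta|exact: E].
Qed.

Lemma convex_hull_conv (A : set 'rV[R]_n.+1) x y (t : R) :
  convex_hull A x -> convex_hull A y -> 0 <= t <= 1 ->
  convex_hull A (t *: x + (1 - t) *: y).
Proof.
move=> Ax Ay /andP[t0 t1] B [cB AB].
have := cB x y (Itv01 t0 t1) (mem_set (Ax B (conj cB AB))) (mem_set (Ay B (conj cB AB))).
by move/set_mem.
Qed.

(** Such an [x] lies between the origin and the point of the inverted graph in its direction; the
    origin is in the hull because it lies between two points of the inverted graph in opposite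
    directions. *)
Lemma homog_lt1_hull g x : (forall x, sphere x -> 0 < g x) -> x != 0 ->
  homog g (- x) < 1 -> convex_hull (@inversion R n.+1 @` graph g) x.
Proof.
move=> g0 x0 gx1; set K := convex_hull _.
have MK theta : sphere theta -> K (- ((g theta)^-1 *: theta)).
  move=> s1; apply: sub_gen_smallest; apply/inv_graphP => //; by exists theta.
have x0' : - x != 0 by rewrite oppr_eq0.
have K0 : K 0.
  have [th s1] : exists th : 'rV[R]_n.+1, sphere th by exists (unitv x); exact: unitv_sphere.
  have s1' := sphereN s1.
  have gp := g0 _ s1; have gm := g0 _ s1'.
  have gpm : 0 < g th + g (- th) by exact: addr_gt0.
  (* With weights proportional to [g th] and [g (- th)] the two opposite vectors cancel. *)
  have -> : 0 = (g th / (g th + g (- th))) *: (- ((g th)^-1 *: th)) +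
     (1 - g th / (g th + g (- th))) *: (- ((g (- th))^-1 *: - th)).
    rewrite !scalerN opprK !scalerA -scaleNr -scalerDl.
    rewrite (_ : _ + _ = 0) ?scale0r//; field.
    by rewrite !gt_eqF.
  apply: convex_hull_conv; [exact: MK|exact: MK|].
  by rewrite divr_ge0 ?(ltW gp) ?(ltW gpm)//= ler_pdivrMr// mul1r lerDl ltW.
have Gx0 := homog_gt0 g0 x0'.
have -> : x = homog g (- x) *: ((homog g (- x))^-1 *: x) + (1 - homog g (- x)) *: 0.
  by rewrite scaler0 addr0 scalerA divff ?scale1r// gt_eqF.
apply: convex_hull_conv => //; last by rewrite (ltW gx1) (ltW Gx0).
have -> : (homog g (- x))^-1 *: x = - ((g (unitv (- x)))^-1 *: unitv (- x)).
  rewrite /homog invfM mulrC -scalerA -scalerN; congr (_ *: _).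
  by rewrite /unitv scalerN opprK.
by apply: MK; exact: unitv_sphere.
Qed.

Lemma derive_lt0_descent (V : normedModType R) (f : V -> R^o) (x v : V) (P : set V) :
  differentiable f x -> 'D_v f x < 0 -> (\forall y \near x, P y) ->
  exists s : R, [/\ 0 < s, P (s *: v + x) & f (s *: v + x) < f x].
Proof.
move=> df; set c := 'D_v f x => c0 nP.
(* With this tolerance the remainder at [s v] is at most half of the linear decrease [- s c]; the
   [+ 1] keeps the denominator positive. *)
pose e := - c / (2 * (`|v| + 1)).
have v1 : 0 < `|v| + 1 by rewrite ltr_wpDl.
have e0 : 0 < e by rewrite divr_gt0 ?oppr_gt0// mulr_gt0.
have nP0 : \forall h \near (0 : V), P (h + x).
  by move: nP; rewrite [X in X -> _](near_shift 0 x); apply: filterS => k /=; rewrite subr0.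
have [r r0 hr] := nbhs_closed_norm_ball (filterI nP0 (differentiable_approx df e0)).
pose s := r / (`|v| + 1).
have s0 : 0 < s by rewrite divr_gt0.
have svr : `|s *: v - 0| <= r.
  rewrite subr0 normrZ gtr0_norm// /s mulrAC ler_pdivrMr// ler_wpM2l ?(ltW r0)//.
  by rewrite lerDl.
have [/= Ps sw] := hr _ svr.
exists s; split=> //.
move: sw; rewrite -(deriveE _ df).
have -> : 'D_(s *: v) f x = s * c by rewrite (deriveE _ df) linearZ /= -(deriveE _ df).
rewrite normrZ (gtr0_norm s0).
have : e * (s * `|v|) <= s * (- c / 2).
  have -> : e * (s * `|v|) = s * (- c / 2) * (`|v| / (`|v| + 1)).
    by rewrite /e; field; rewrite gt_eqF.
  rewrite ler_piMr//; first by rewrite mulr_ge0 ?divr_ge0 ?oppr_ge0// ltW.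
  by rewrite ler_pdivrMr// mul1r lerDl.
have sc : s * c < 0 by rewrite pmulr_rlt0.
move: (e * _) => b h1 /ler_normlP[h2 h3]; lra.
Qed.

Lemma derive_local_min (V : normedModType R) (f : V -> R^o) (x v : V) :
  differentiable f x -> (\forall y \near x, f x <= f y) -> 'D_v f x = 0.
Proof.
move=> df fmin.
have ge0 u : 0 <= 'D_u f x.
  rewrite leNgt; apply/negP => c0.
  have [s [_ h]] := derive_lt0_descent df c0 fmin.
  by rewrite ltNge h.
apply/eqP; rewrite eq_le ge0 andbT -oppr_ge0.
by have := ge0 (- v); rewrite !(deriveE _ df) linearN.
Qed.

(* If G q < <grad G theta, q>, the ray from q / G q through p = theta / G theta
   enters {G < 1} just after p, so p would be interior to the convex hull. *)
Lemma convex_integrand_grad_le g theta q :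
  smooth_on (@sphere R n) (g : _ -> R^o) -> convex_integrand g ->
  sphere theta -> sphere q -> dotp (grad g theta) q <= g q.
Proof.
move=> sg [_ g0 bd] th1 q1; rewrite leNgt; apply/negP => gq.
set K := convex_hull _ in bd.
have th0 := sphere_neq0 th1.
have gth := g0 _ th1; have gqp := g0 _ q1.
pose p := - ((g theta)^-1 *: theta); pose q' := - ((g q)^-1 *: q).
have Mp : (@inversion R n.+1 @` graph g) p by apply/inv_graphP => //; exists theta.
have Kq' : K q' by apply: sub_gen_smallest; apply/inv_graphP => //; exists q.
have dg := homog_differentiable sg th0.
pose w := theta - (g theta / g q) *: q.
have c0 : 'D_w (homog g : _ -> R^o) theta < 0.
  rewrite derive_grad// /w dotpDr grad_euler// homog_sphere// dotpNr dotpZr subr_lt0.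
  by rewrite mulrAC ltr_pdivlMr// ltr_pM2l.
have near0 : \forall h \near theta, h != 0.
  by apply: open_nbhs_nbhs; split=> //; exact: open_nonzero.
have [s [s0 sw0]] := derive_lt0_descent dg c0 near0.
rewrite (homog_sphere g th1) => psi.
pose z := - ((g theta)^-1 *: (s *: w + theta)).
have gi0 : 0 < (g theta)^-1 by rewrite invr_gt0.
have z0 : z != 0 by rewrite oppr_eq0 scaler_eq0 negb_or gt_eqF.
have Gz : homog g (- z) < 1.
  by rewrite opprK homogZ// mulrC ltr_pdivrMr// mul1r.
pose O := [set x | x != 0] `&` ((fun x => homog g (- x)) @^-1` [set t | t < 1]).
have oO : open O.
  apply: open_preimage_in; [exact: open_nonzero|exact: open_lt|move=> x x0].
  apply: (@continuous_comp _ _ _ (fun x : 'rV[R]_n.+1 => - x) (homog g : _ -> R^o)).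
    exact: opp_continuous.
  by apply: Cinf_continuous (Cinf_homog sg) _; rewrite /= oppr_eq0.
have OK : O `<=` K by move=> x [x0 gx]; exact: homog_lt1_hull.
have zE : z = (1 + s) *: p - s *: q'.
  apply/rowP => j; rewrite !mxE; field.
  by rewrite !gt_eqF.
have : boundary K p by rewrite bd.
case=> _; apply.
(* The homothety [y |-> (1 + s) y - s q'] sends [p] to [z], hence a neighbourhood of [p] into the
   open set [O] inside the hull; such a [y] lies between its image and [q'], so it is in the hull as
   well. *)
have Tc : (fun y => (1 + s) *: y - s *: q') @ p --> z.
  rewrite zE.
  apply: (@cvgB _ _ _ (nbhs p) _ (fun y => (1 + s) *: y) (cst (s *: q'))); last exact: cvg_cst.
  exact: scaler_continuous.
have : \forall y \near p, O ((1 + s) *: y - s *: q').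
  exact: (Tc O (open_nbhs_nbhs (conj oO (conj z0 Gz)))).
suff KO y : O ((1 + s) *: y - s *: q') -> K y by move=> h; exact: (filterS KO h).
move=> /OK Ky.
have s1 : 0 < 1 + s by rewrite addr_gt0.
have -> : y = (1 + s)^-1 *: ((1 + s) *: y - s *: q') + (1 - (1 + s)^-1) *: q'.
  apply/rowP => j; rewrite !mxE; field.
  by rewrite !gt_eqF.
apply: convex_hull_conv => //.
by rewrite invr_ge0 (ltW s1) invf_le1// lerDl ltW.
Qed.

Lemma closed_wulff g : closed (wulff g).
Proof.
apply: closed_bigI => theta _.
apply: (@closed_comp _ _ (fun x => dotp x theta) [set t | t <= g theta]); last exact: closed_le.
by move=> x _; exact: dotp_continuous.
Qed.

Lemma compact_sphere : compact (@sphere R n).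
Proof.
apply: bounded_closed_compact.
  exists 1; split; first exact: num_real.
  move=> M M1 x x1; apply: le_trans (norm_le_enorm x) _.
  by rewrite (x1 : enorm x = 1) ltW.
have -> : @sphere R n = (fun x => dotp x x) @^-1` [set 1].
  apply/seteqP; split=> x /=; first exact: sphere_dotp.
  by rewrite /sphere /= /enorm => ->; rewrite sqrtr1.
apply: closed_comp; last exact: closed_eq.
move=> x _; apply: (@Cinf_continuous _ _ _ setT _ _ _ I).
by apply: Cinf_dotp; [exact: openT|exact: Cinf_id|exact: Cinf_id].
Qed.

Lemma dotp_norm_le x theta : sphere theta -> dotp x theta <= n.+1%:R * `|x|.
Proof.
move=> t1; rewrite (le_trans (ler_norm _))// (le_trans (ler_norm_sum _ _ _))//.
rewrite mulr_natl -[X in _ *+ X](card_ord n.+1) -sumr_const ler_sum// => i _.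
rewrite normrM -[leRHS]mulr1 ler_pM ?row_entry_norm//.
by rewrite (le_trans (dotp_entry_le _ _))// (t1 : enorm theta = 1).
Qed.

(** Polarity: the points [- eta / d eta] satisfy every constraint [<x, theta> <= g theta], every
    constraint is attained by one of them, and each of them attains one. Unlike [dual_integrand],
    this form is visibly symmetric in [g] and [d]. *)
Definition dual_pair g d :=
  [/\ Cinf_pos g /\ Cinf_pos d,
      forall theta eta, sphere theta -> sphere eta -> - dotp theta eta <= g theta * d eta,
      forall theta, sphere theta -> exists2 eta, sphere eta & - dotp theta eta = g theta * d eta &
      forall eta, sphere eta -> exists2 theta, sphere theta & - dotp theta eta = g theta * d eta].

Lemma dual_pair_sym g d : dual_pair g d -> dual_pair d g.
Proof.
move=> [[cg cd] h1 h2 h3]; split=> // [theta eta t1 e1|theta t1|eta e1].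
- by rewrite dotpC mulrC; exact: h1.
- by have [eta e1 E] := h3 _ t1; exists eta => //; rewrite dotpC mulrC.
- by have [theta t1 E] := h2 _ e1; exists theta => //; rewrite dotpC mulrC.
Qed.

(** The closed Wulff shape contains its boundary, whence the inequality. The contact point for
    [theta] is [grad g theta], which satisfies all constraints, and that of [theta] with equality by
    Euler's identity. A boundary point without contact would have a positive minimal slack over the
    compact sphere, hence be interior. *)
Lemma dual_integrand_pair g d : Cinf_pos g -> Cinf_pos d ->
  convex_integrand g -> dual_integrand g d -> dual_pair g d.
Proof.
move=> [sg g0] [sd d0] cg [_ bd].
have bdP y : boundary (wulff g) y <-> exists2 eta, sphere eta & y = - ((d eta)^-1 *: eta).
  by rewrite -bd; exact: inv_graphP.
have bW y : boundary (wulff g) y -> wulff g y.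
  by case=> + _; rewrite -(closure_id _).1//; exact: closed_wulff.
have Edot theta eta : sphere eta ->
    dotp (- ((d eta)^-1 *: eta)) theta = - dotp theta eta / d eta.
  by move=> _; rewrite dotpNl dotpZl dotpC mulNr mulrC.
split=> // [theta eta t1 e1|theta t1|eta e1].
- have /bW/(_ _ t1) /= : boundary (wulff g) (- ((d eta)^-1 *: eta)) by apply/bdP; exists eta.
  by rewrite Edot// ler_pdivrMr// d0.
- pose p := grad g theta.
  have pt : dotp p theta = g theta by rewrite grad_euler ?homog_sphere//; exact: sphere_neq0.
  have Wp : wulff g p by move=> q q1 /=; exact: convex_integrand_grad_le.
  have : boundary (wulff g) p.
    split; first exact: subset_closure.
    move=> /nbhs_closed_norm_ball[r r0 hr].
    (* Pushing [p] outwards along [theta] violates the constraint of [theta], so [p] is not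
       interior. *)
    have : wulff g (p + r *: theta).
      apply: hr; rewrite addrAC subrr add0r normrZ gtr0_norm// -[leRHS]mulr1.
      by rewrite ler_wpM2l ?(ltW r0)// -(t1 : enorm theta = 1) norm_le_enorm.
    move=> /(_ _ t1) /=; rewrite dotpDl dotpZl pt sphere_dotp// mulr1.
    by rewrite gerDl leNgt r0.
  move=> /bdP[eta e1 pE]; exists eta => //.
  by rewrite -pt pE Edot// divfK// gt_eqF// d0.
- set w := - ((d eta)^-1 *: eta).
  have Bw : boundary (wulff g) w by apply/bdP; exists eta.
  have [||th /set_mem t1 tmin] := @EVT_min_rV R n.+1 (fun th => g th - dotp w th) _ _ compact_sphere.
  + by exists eta.
  + have [cg' _ _] := cg; move=> x; apply: cvgB; first exact: cg'.
    apply: continuous_subspaceT => y.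
    have -> : dotp w = (fun y => dotp y w) by apply/funext => z; exact: dotpC.
    exact: dotp_continuous.
  exists th => //.
  have := bW _ Bw _ t1; rewrite /= le_eqVlt => /orP[/eqP E|lt].
    by rewrite -E Edot// divfK// gt_eqF// d0.
  exfalso; case: Bw => _; apply.
  (* The factor [n.+1] bounds a product with a unit vector by the sup norm, so a displacement
     smaller than [e] does not exceed the minimal slack. *)
  pose e := (g th - dotp w th) / n.+1%:R.
  have e0 : 0 < e by rewrite divr_gt0// subr_gt0.
  apply/nbhs_ballP; exists e => //= y; rewrite -ball_normE /= distrC => ye q q1 /=.
  have := tmin q (mem_set q1).
  have := dotp_norm_le (y - w) q1; rewrite dotpDl dotpNl.
  have : n.+1%:R * `|y - w| <= g th - dotp w th.
    by rewrite mulrC -ler_pdivlMr// ltW.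
  by move: (n.+1%:R * _) => a; lra.
Qed.

End ConvexIntegrand.

(** * Gauss maps of a dual pair *)

Section DualPair.
Context {R : realType} {n : nat}.
Implicit Types (g d : 'rV[R]_n.+1 -> R) (theta eta : 'rV[R]_n.+1).

Lemma dual_pair_homog g d x y : dual_pair g d -> x != 0 -> y != 0 ->
  - dotp x y <= homog g x * homog d y.
Proof.
move=> [_ h _ _] x0 y0; have := h _ _ (unitv_sphere x0) (unitv_sphere y0).
have ex := enorm_gt0 x0; have ey := enorm_gt0 y0.
rewrite /homog [enorm x * _]mulrC [enorm y * _]mulrC mulrACA.
rewrite /unitv dotpZl dotpZr -/(unitv x) -/(unitv y).
move=> {}h; rewrite -ler_pdivrMr ?mulr_gt0//; apply: le_trans h.
by rewrite invfM mulrC !mulrN mulrA.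
Qed.

(** The function [d eta G x + <x, eta>] is nonnegative off the origin and vanishes at [theta], so
    its derivative there is zero. *)
Lemma dual_pair_grad g d theta eta : dual_pair g d -> sphere theta -> sphere eta ->
  - dotp theta eta = g theta * d eta -> grad g theta = - ((d eta)^-1 *: eta).
Proof.
move=> gd t1 e1 E; have [[[sg g0] [sd d0]] _ _ _] := gd.
have t0 := sphere_neq0 t1; have e0 := sphere_neq0 e1.
have dG := homog_differentiable sg t0.
have dl : differentiable (fun x => dotp x eta : R^o) theta.
  apply: (@Cinf_differentiable _ _ _ setT _ _ _ I).
  by apply: Cinf_dotp; [exact: openT|exact: Cinf_id|exact: Cinf_cst].
pose h : 'rV[R]_n.+1 -> R^o := d eta \*: (homog g : _ -> R^o) + (fun x => dotp x eta).
have dh : differentiable h theta by apply: differentiableD => //; exact: differentiableZ.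
have hmin : \forall y \near theta, h theta <= h y.
  have near0 : \forall y \near theta, y != 0.
    by apply: open_nbhs_nbhs; split=> //; exact: open_nonzero.
  near=> y; have y0 : y != 0 by near: y.
  have := dual_pair_homog gd y0 e0; rewrite (homog_sphere _ e1).
  have -> : h theta = d eta * homog g theta + dotp theta eta by [].
  have -> : h y = d eta * homog g y + dotp y eta by [].
  rewrite (homog_sphere _ t1).
  move: E; move: (g theta) (d eta) (homog g y) (dotp theta eta) (dotp y eta) => a b c k l; lra.
apply: dotp_inj => v; have := derive_local_min v dh hmin.
rewrite /h deriveD; [|apply: diff_derivable..] => //; last exact: differentiableZ.
rewrite deriveZ; last exact: diff_derivable.
rewrite derive_grad//.
have -> : 'D_v (fun x => dotp x eta : R^o) theta = dotp v eta.
  have -> : (fun x => dotp x eta : R^o) = (fun x => (x *m eta^T) 0 0).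
    by apply/funext => x; rewrite dotpE.
  have di : differentiable (id : 'rV[R]_n.+1 -> _) theta by exact: (@ex_diff _ _ _ _ _ id id).
  have dm : differentiable (fun x : 'rV[R]_n.+1 => x *m eta^T) theta.
    apply: (@Cinf_differentiable _ _ _ setT _ _ _ I).
    by apply: Cinf_mulmxr; [exact: openT|exact: Cinf_id].
  by rewrite -(derive_row_mxE v 0 0 dm) derive_mulmxr// derive_id dotpE.
rewrite /GRing.scale /= => H; rewrite dotpNl dotpZl.
have de := d0 _ e1.
apply: (mulfI (lt0r_neq0 de)); rewrite mulrN mulrA divff ?lt0r_neq0// mul1r.
by apply/eqP; rewrite -addr_eq0 (dotpC eta) H.
Unshelve. all: by end_near. Qed.

Definition gauss g x : 'rV[R]_n.+1 := - unitv (grad g x).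

Lemma grad_neq0 g x : Cinf_pos g -> x != 0 -> grad g x != 0.
Proof.
move=> [sg g0] x0; apply/eqP => gr0; have := homog_gt0 g0 x0.
by rewrite -grad_euler// gr0 dotpE mul0mx mxE ltxx.
Qed.

Lemma gauss_sphere g x : Cinf_pos g -> x != 0 -> sphere (gauss g x).
Proof. by move=> cg x0; apply: sphereN; apply: unitv_sphere; exact: grad_neq0. Qed.

Lemma Cinf_gauss g : Cinf_pos g -> Cinf [set x | x != 0] (gauss g).
Proof.
move=> cg; have o := @open_nonzero R n.+1.
have C1 : Cinf [set x | x != 0] (unitv \o grad g).
  apply: (Cinf_comp_row o o _ (Cinf_grad cg.1) Cinf_unitv) => x.
  exact: grad_neq0.
apply/(Cinf_row _ o) => j.
by apply: Cinf_ext (CinfN o (Cinf_entry 0 j o C1)) => x; rewrite !mxE.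
Qed.

(** The gradient determines the contact direction, which is therefore [gauss g theta]. The contact
    relation is symmetric, so the same argument for [(d, g)] leads back to [theta]. *)
Lemma dual_pair_gauss g d theta : dual_pair g d -> sphere theta ->
  [/\ - dotp theta (gauss g theta) = g theta * d (gauss g theta),
      d (gauss g theta) = (enorm (grad g theta))^-1 &
      gauss d (gauss g theta) = theta].
Proof.
move=> gd t1.
have main g' d' th et : dual_pair g' d' -> sphere th -> sphere et ->
    - dotp th et = g' th * d' et -> gauss g' th = et.
  move=> gd' th1 et1 E; rewrite /gauss (dual_pair_grad gd' th1 et1 E).
  have [[_ [_ d0]] _ _ _] := gd'.
  rewrite -[X in unitv X]scalerN unitvZ ?invr_gt0 ?d0// unitv_id ?opprK//.
  exact: sphereN.
have [[cg [_ d0]] _ ex _] := gd; have [eta e1 E] := ex _ t1.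
have ge := main _ _ _ _ gd t1 e1 E; rewrite ge; split=> //.
  rewrite (dual_pair_grad gd t1 e1 E) enormN enormZ ?invr_gt0 ?d0//.
  by rewrite (e1 : enorm eta = 1) mulr1 invrK.
apply: main (dual_pair_sym gd) e1 t1 _.
by rewrite dotpC E mulrC.
Qed.

End DualPair.

(** * Charts *)

Section Charts.
Context {R : realType} {n : nat}.

Lemma smooth_on_open (V : normedModType R) m (A : set 'rV[R]_m) (f : 'rV[R]_m -> V) :
  open A -> Cinf A f -> smooth_on A f.
Proof. by move=> oA Cf x Ax; exists A, f; split. Qed.

Lemma Cinf_chart_inv U phi (psi : 'rV[R]_n -> 'rV[R]_n.+1) : chart U phi psi ->
  Cinf (phi @` U) psi.
Proof.
move=> [_ oU [_ _ _ spsi]].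
by apply: (smooth_on_comp_row (u := id) oU spsi) => //; exact: Cinf_id.
Qed.

Lemma chart_sphere U phi (psi : 'rV[R]_n -> 'rV[R]_n.+1) x : chart U phi psi ->
  (phi @` U) x -> [/\ U (psi x), sphere (psi x) & phi (psi x) = x].
Proof.
move=> [[W _ UE] _ [_ h _ _]] /h[Ux px]; split=> //.
by move: Ux; rewrite UE => -[].
Qed.

(** [N] moves the chart along a diffeomorphism of the sphere, while [T] changes coordinates on a
    smaller domain [B]; the latter serves to put a function in normal form after the transport. *)
Lemma chart_transport (N N' : 'rV[R]_n.+1 -> 'rV[R]_n.+1) U phi psi
    (B C : set 'rV[R]_n) (T T' : 'rV[R]_n -> 'rV[R]_n) :
  Cinf [set x | x != 0] N -> Cinf [set x | x != 0] N' ->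
  (forall x, sphere x -> sphere (N x) /\ N' (N x) = x) ->
  (forall x, sphere x -> sphere (N' x) /\ N (N' x) = x) ->
  chart U phi psi -> open B -> open C -> B `<=` phi @` U ->
  Cinf B T -> Cinf C T' ->
  (forall x, B x -> C (T x) /\ T' (T x) = x) ->
  (forall y, C y -> B (T' y) /\ T (T' y) = y) ->
  let U' := [set y | sphere y /\ U (N' y) /\ B (phi (N' y))] in
  chart U' (T \o phi \o N') (N \o psi \o T') /\ (T \o phi \o N') @` U' = C.
Proof.
move=> CN CN' NP N'P ch oB oC BU CT CT' TP T'P U'.
have Cpsi := Cinf_chart_inv ch.
have chS x := @chart_sphere U phi psi x ch.
have [[W0 oW0 UE] oU [phiP psiP sphi spsi]] := ch.
have o0 := @open_nonzero R n.+1.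
have imE : (T \o phi \o N') @` U' = C.
  apply/seteqP; split=> [_ [y [_ [_ By]] <-]|y Cy /=]; first exact: (TP _ By).1.
  have [Bx Tx] := T'P _ Cy; have [Uu u1 phiu] := chS _ (BU _ Bx).
  have [Nu N'u] := NP _ u1.
  by exists (N (psi (T' y))); rewrite /U' /= N'u ?phiu.
(* [phi] is smooth only as a map on part of the sphere. Near [N' y] it is replaced by a smooth
   extension [F], and [O] is cut down so that its trace on the sphere stays in [U'] and [F] takes
   values in [B] on a neighbourhood [Q2] of the image of [O]. *)
have locext y : U' y -> exists (O Q2 : set 'rV[R]_n.+1) (F : 'rV[R]_n.+1 -> 'rV[R]_n),
    [/\ [/\ open O, O y, O `&` @sphere R n `<=` U' & O `<=` [set x | x != 0]],
        [/\ open Q2, forall z, Q2 z -> B (F z), forall z, O z -> Q2 (N' z) & Cinf Q2 F]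
        & forall z, U' z -> O z -> phi (N' z) = F (N' z)].
  move=> [y1 [Uy By]].
  have [W [F [oW Wy CF phiF]]] := sphi _ Uy.
  pose Q2 := W `&` F @^-1` B.
  have oQ2 : open Q2.
    by apply: open_preimage_in => // x; apply: Cinf_continuous CF.
  pose O := [set x : 'rV[R]_n.+1 | x != 0] `&` N' @^-1` (W0 `&` Q2).
  have oO : open O.
    apply: open_preimage_in => //; first exact: openI.
    by move=> x; apply: Cinf_continuous CN'.
  exists O, Q2, F; split=> //.
  - split=> //.
    + split; first exact: sphere_neq0.
      by move: Uy (Uy); rewrite {1}UE => -[W0y _] Uy; split=> //; split=> //=; rewrite -phiF.
    + move=> z [[z0 [W0z [Wz Bz]]] z1].
      have UN : U (N' z) by rewrite UE; split=> //; exact: (N'P _ z1).1.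
      by split=> //; split=> //; rewrite phiF.
    + by move=> z [].
  - split=> //.
    + by move=> z [].
    + by move=> z [_ []].
    + by apply: Cinf_sub CF => z [].
  - by move=> z [_ [Uz _]] [_ [_ [Wz _]]]; rewrite phiF.
split=> //; split.
(* Taking the union of all admissible open sets avoids choosing one for each point. *)
- exists (\bigcup_(O in [set O : set 'rV[R]_n.+1 | open O /\ O `&` @sphere R n `<=` U']) O).
    by apply: bigcup_open => O [].
  apply/seteqP; split=> [y Uy|y [ [Q [_ OU] Oy] y1]]; last exact: OU.
  split; last by case: Uy.
  by have [Q [Q2 [F [[oO Oy OU _] _ _]]]] := locext y Uy; exists Q.
- by rewrite imE.
- rewrite imE; split=> [y [y1 [Uy By]]|y Cy||].
  + have [CT1 T'T] := TP _ By; split=> //=.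
    by rewrite T'T (phiP _ Uy).2 (N'P _ y1).2.
  + have [Bx Tx] := T'P _ Cy; have [Uu u1 phiu] := chS _ (BU _ Bx).
    have [Nu N'u] := NP _ u1.
    by rewrite /U' /= N'u phiu.
  + move=> y Uy; have [Q [Q2 [F [[oO Oy OU O0] [oQ2 FB ON' CF] phiF]]]] := locext y Uy.
    exists Q, (T \o F \o N'); split=> //.
      apply: (Cinf_comp_row oO oQ2 ON' (Cinf_sub O0 CN')).
      exact: (Cinf_comp_row oQ2 oB FB CF CT).
    by move=> z Uz Oz /=; rewrite phiF.
  + apply: smooth_on_open => //.
    have ne y : (phi @` U) y -> psi y != 0 by move=> /chS[_ y1 _]; exact: sphere_neq0.
    have C1 : Cinf (phi @` U) (N \o psi) by exact: (Cinf_comp_row oU o0 ne Cpsi CN).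
    by apply: (Cinf_comp_row oC oU _ CT' C1) => y /T'P[/BU].
Qed.

Lemma jac_comp m p q (f : 'rV[R]_m -> 'rV[R]_p) (g : 'rV[R]_p -> 'rV[R]_q) x :
  differentiable f x -> differentiable g (f x) ->
  jac (g \o f) x = jac f x *m jac g (f x).
Proof.
move=> df dg; have dc := differentiable_comp df dg.
apply/row_matrixP => i; rewrite row_mul !rowE -derive_jac// -derive_jac//.
by rewrite -derive_jac// (deriveE _ dc) (diff_comp df dg) /= (deriveE _ df) (deriveE _ dg).
Qed.

Lemma jac_near_eq m p (f g : 'rV[R]_m -> 'rV[R]_p) x :
  {near x, f =1 g} -> jac f x = jac g x.
Proof. by move=> fg; apply/matrixP => i j; rewrite !mxE (near_eq_derive _ fg). Qed.

Lemma jac_id m (x : 'rV[R]_m) : jac id x = 1%:M.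
Proof. by apply/matrixP => i j; rewrite !mxE derive_id !mxE eqxx eq_sym. Qed.

(** A local smooth extension [F] of [phi] satisfies [F \o psi = id] near [x], so [jac F] is a right
    inverse of [jac psi]. *)
Lemma chart_inv_jac_free U phi (psi : 'rV[R]_n -> 'rV[R]_n.+1) x : chart U phi psi ->
  (phi @` U) x -> row_free (jac psi x).
Proof.
move=> ch Ux; have [Upx _ phix] := chart_sphere ch Ux.
have Cpsi := Cinf_chart_inv ch.
have [_ oU [_ psiP sphi _]] := ch.
have [W [F [oW Wx CF phiF]]] := sphi _ Upx.
have dpsi := Cinf_differentiable Cpsi Ux.
have dF := Cinf_differentiable (CF : Cinf W F) Wx.
apply/row_freeP; exists (jac F (psi x)); rewrite -jac_comp// -(jac_id x).
apply: jac_near_eq; near=> y.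
have Uy : (phi @` U) y by near: y; exact: open_nbhs_nbhs.
have [Upy _ phiy] := chart_sphere ch Uy.
rewrite /= -phiF//; near: y; apply: (Cinf_continuous Cpsi Ux).
exact: open_nbhs_nbhs.
Unshelve. all: by end_near. Qed.

End Charts.

(** * Non-degenerate critical points *)

Section ChartRelations.
Context {R : realType}.

Lemma derive_dotp (V : normedModType R) m (a b : V -> 'rV[R]_m) x v :
  differentiable a x -> differentiable b x ->
  'D_v (fun y => dotp (a y) (b y) : R^o) x = dotp ('D_v a x) (b x) + dotp (a x) ('D_v b x).
Proof.
move=> da db.
have dai i : derivable (fun y => a y 0 i : R^o) x v.
  by apply: diff_derivable; exact: differentiable_entry.
have dbi i : derivable (fun y => b y 0 i : R^o) x v.
  by apply: diff_derivable; exact: differentiable_entry.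
have -> : (fun y => dotp (a y) (b y) : R^o) =
    \sum_(i < m) ((fun y => a y 0 i : R^o) * (fun y => b y 0 i : R^o)).
  by apply/funext => y; rewrite fct_sumE.
rewrite derive_sum => [|i]; last exact: derivableM.
rewrite /dotp -big_split; apply: eq_bigr => i _.
rewrite deriveM// (derive_row_mxE _ _ _ da) (derive_row_mxE _ _ _ db) addrC.
by rewrite /GRing.scale /= [X in X + _]mulrC.
Qed.

(** The independent rows of [J] lie in the hyperplane orthogonal to [s], whose dimension is also
    [n], so they span it. *)
Lemma row_perp_sub n (J : 'M[R]_(n, n.+1)) (s z : 'rV[R]_n.+1) : row_free J ->
  dotp s s = 1 -> (forall j, dotp s (row j J) = 0) -> dotp s z = 0 -> (z <= J)%MS.
Proof.
move=> fJ s1 sJ sz.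
have Jk : (J <= kermx s^T)%MS.
  apply/row_subP => j; apply/sub_kermxP; apply/rowP => k.
  by rewrite ord1 -dotpE dotpC sJ mxE.
have zk : (z <= kermx s^T)%MS.
  by apply/sub_kermxP; apply/rowP => k; rewrite ord1 -dotpE dotpC sz mxE.
apply: submx_trans zk _; rewrite -(mxrank_leqif_sup Jk).
rewrite mxrank_ker mxrank_tr (eqP (fJ : \rank J == n)).
have -> : \rank s = 1%N; last by rewrite subSS subn0.
apply/eqP; rewrite eqn_leq rank_leq_row lt0n mxrank_eq0.
by rewrite -dotp_eq0 s1 oner_neq0.
Qed.

(** The difference [z - w] is orthogonal to [s], hence in the row space of [J], to which it is
    orthogonal too. *)
Lemma row_perp_eq n (J : 'M[R]_(n, n.+1)) (s z w : 'rV[R]_n.+1) : row_free J ->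
  dotp s s = 1 -> (forall j, dotp s (row j J) = 0) ->
  (forall j, dotp z (row j J) = dotp w (row j J)) -> dotp z s = dotp w s -> z = w.
Proof.
move=> fJ s1 sJ zJ zs; apply/eqP; rewrite -subr_eq0 -dotp_eq0.
have /submxP[u E] : (z - w <= J)%MS.
  by apply: row_perp_sub fJ s1 sJ _; rewrite dotpDr dotpNr !(dotpC s) zs subrr.
rewrite [X in dotp _ X]E mulmx_sum_row; apply/eqP.
have -> : dotp (z - w) (\sum_i u 0 i *: row i J) = \sum_i u 0 i * dotp (z - w) (row i J).
  apply: (big_ind2 (fun a b => dotp (z - w) a = b)) => [|a b a' b' <- <-|i _].
  - by rewrite dotpC dotpE mul0mx mxE.
  - exact: dotpDr.
  - exact: dotpZr.
by rewrite big1// => i _; rewrite dotpDl dotpNl zJ subrr mulr0.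
Qed.

(* Since u u h = 1, multiplying its derivative by u isolates D u. *)
Lemma derive_inv_sqr (V : normedModType R) (u h : V -> R^o) x v :
  differentiable u x -> differentiable h x ->
  (\forall y \near x, u y * u y * h y = 1) ->
  'D_v u x = - (2^-1 * (u x * u x * u x)) * 'D_v h x.
Proof.
move=> /(@diff_derivable _ _ _ _ _ v) du /(@diff_derivable _ _ _ _ _ v) dh uh1.
have duu : derivable (u * u) x v by exact: derivableM.
have E : 'D_v (u * u * h) x = 0.
  by rewrite -(derive_cst (1 : R^o) x v); exact: near_eq_derive.
have uh := nbhs_singleton uh1.
move: E; rewrite (deriveM duu dh) (deriveM du du).
rewrite (_ : (u * u) x = u x * u x)// /GRing.scale /=.
move: uh; move: ('D_v u x : R) ('D_v h x : R) (u x : R) (h x : R) => a b c k uh E.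
have uha : a * (c * c * k) = a by rewrite uh mulr1.
have : c * (c * c * b + k * (c * a + c * a)) = 0 by rewrite E mulr0.
lra.
Qed.

Context {n : nat} {g d : 'rV[R]_n.+1 -> R} {U : set 'rV[R]_n.+1}
  {phi : 'rV[R]_n.+1 -> 'rV[R]_n} {psi : 'rV[R]_n -> 'rV[R]_n.+1}.
Hypothesis gd : dual_pair g d.
Hypothesis ch : chart U phi psi.
Let Om := phi @` U.
Let f : 'rV[R]_n -> R^o := g \o psi.
Let p := grad g \o psi.

Let cg : Cinf_pos g. Proof. by have [[]] := gd. Qed.

Lemma chart_open : open Om. Proof. by have [] := ch. Qed.
Let oOm := chart_open.

Lemma chart_inv_neq0 y : Om y -> psi y != 0.
Proof. by move=> /(chart_sphere ch)[_ h _]; exact: sphere_neq0. Qed.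

Lemma chart_inv_dotp y : Om y -> dotp (psi y) (psi y) = 1.
Proof. by move=> /(chart_sphere ch)[_ h _]; exact: sphere_dotp. Qed.

Let Cpsi : Cinf Om psi := Cinf_chart_inv ch.

Lemma Cinf_chart_grad : Cinf Om p.
Proof. by apply: (Cinf_comp_row oOm (@open_nonzero R n.+1) chart_inv_neq0 Cpsi (Cinf_grad cg.1)). Qed.
Let Cp := Cinf_chart_grad.

Lemma chart_euler y : Om y -> dotp (p y) (psi y) = f y.
Proof.
move=> Oy; have [_ s1 _] := chart_sphere ch Oy.
by rewrite /p /= grad_euler ?homog_sphere//; [exact: cg.1|exact: sphere_neq0].
Qed.

Let dpsi y : Om y -> differentiable psi y. Proof. exact: Cinf_differentiable. Qed.
Let dp y : Om y -> differentiable p y. Proof. exact: Cinf_differentiable. Qed.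

Lemma chart_derive_fun y v : Om y -> 'D_v f y = dotp (p y) ('D_v psi y).
Proof.
move=> Oy.
have dG := homog_differentiable cg.1 (chart_inv_neq0 Oy).
have dc := differentiable_comp (dpsi Oy) dG.
rewrite -derive_grad// (deriveE _ dG) (deriveE _ (dpsi Oy)).
rewrite -[RHS]/(('d (homog g : _ -> R^o) (psi y) \o 'd psi y) v) -(diff_comp (dpsi Oy) dG).
rewrite -(deriveE _ dc); apply: near_eq_derive; apply: (open_near_eq oOm Oy) => z.
by move=> /(chart_sphere ch)[_ s1 _]; rewrite /f /= homog_sphere.
Qed.

Lemma chart_inv_perp y v : Om y -> dotp (psi y) ('D_v psi y) = 0.
Proof.
move=> Oy; have := derive_dotp v (dpsi Oy) (dpsi Oy).
have -> : 'D_v (fun z => dotp (psi z) (psi z) : R^o) y = 'D_v (cst 1 : _ -> R^o) y.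
  by apply: near_eq_derive; apply: (open_near_eq oOm Oy) => z /chart_inv_dotp.
rewrite derive_cst dotpC => h; move: h; move: (dotp _ _) => a; lra.
Qed.

(** Differentiating [<p, psi> = f] gives two terms, of which [<p, D psi>] already equals [D f]; the
    other one vanishes. *)
Lemma chart_grad_perp y v : Om y -> dotp (psi y) ('D_v p y) = 0.
Proof.
move=> Oy; have := derive_dotp v (dp Oy) (dpsi Oy).
have -> : 'D_v (fun z => dotp (p z) (psi z) : R^o) y = 'D_v f y.
  by apply: near_eq_derive; apply: (open_near_eq oOm Oy) => z /chart_euler.
rewrite chart_derive_fun// => /eqP; rewrite -subr_eq0 opprD addrCA subrr addr0 oppr_eq0 => /eqP.
by rewrite dotpC.
Qed.

Lemma row_jac_derive m q (h : 'rV[R]_m -> 'rV[R]_q) y j :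
  differentiable h y -> row j (jac h y) = 'D_(delta_mx 0 j) h y.
Proof. by move=> dh; rewrite rowE derive_jac. Qed.

Lemma chart_inv_perp_row y j : Om y -> dotp (psi y) (row j (jac psi y)) = 0.
Proof. by move=> Oy; rewrite row_jac_derive ?chart_inv_perp//; exact: dpsi. Qed.

Lemma chart_partial j y : Om y -> partial j f y = dotp (p y) (row j (jac psi y)).
Proof. by move=> Oy; rewrite /partial chart_derive_fun// row_jac_derive//; exact: dpsi. Qed.

Lemma chart_jac_free y : Om y -> row_free (jac psi y).
Proof. exact: (chart_inv_jac_free ch). Qed.

(** The rows of [jac p] are orthogonal to [psi], hence combinations of those of [jac psi].
    Conversely the Gauss map of [d] recovers [psi] from [p], so both Jacobians have rank [n] and [M]
    is invertible. *)
Lemma chart_grad_factor y : Om y ->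
  exists2 M : 'M[R]_n, M \in unitmx & jac p y = M *m jac psi y.
Proof.
move=> Oy; have fJ := chart_jac_free Oy.
have /submxP[M ME] : (jac p y <= jac psi y)%MS.
  apply/row_subP => j; apply: (row_perp_sub fJ (chart_inv_dotp Oy)).
    by move=> k; exact: chart_inv_perp_row.
  by rewrite row_jac_derive ?chart_grad_perp//; exact: dp.
exists M => //.
have o0 := @open_nonzero R n.+1.
pose Psi q := gauss d (- unitv q).
have [[_ cd] _ _ _] := gd.
have Cu : Cinf [set x : 'rV[R]_n.+1 | x != 0] (fun q => - unitv q).
  apply/(Cinf_row _ o0) => j.
  by apply: Cinf_ext (CinfN o0 (Cinf_entry 0 j o0 (@Cinf_unitv R n.+1))) => x; rewrite !mxE.
have CPsi : Cinf [set x : 'rV[R]_n.+1 | x != 0] Psi.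
  apply: (Cinf_comp_row o0 o0 _ Cu (Cinf_gauss cd)) => x x0.
  by apply: sphere_neq0; apply: sphereN; exact: unitv_sphere.
have p0 : p y != 0 by apply: grad_neq0 => //; exact: chart_inv_neq0.
have dPsi := Cinf_differentiable CPsi p0.
have JE : jac psi y = jac p y *m jac Psi (p y).
  rewrite -(jac_comp (dp Oy) dPsi); apply: jac_near_eq; apply: (open_near_eq oOm Oy) => z Oz.
  have [_ s1 _] := chart_sphere ch Oz.
  by have [_ _] := dual_pair_gauss gd s1.
rewrite -row_free_unit /row_free eqn_leq rank_leq_row /=.
rewrite -{1}(eqP (fJ : \rank (jac psi y) == n)) JE.
by rewrite (leq_trans (mxrankM_maxl _ _))// ME mxrankM_maxl.
Qed.

Lemma chart_crit x : Om x -> (forall j, partial j f x = 0) -> p x = f x *: psi x.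
Proof.
move=> Ox cr; apply: (row_perp_eq (chart_jac_free Ox) (chart_inv_dotp Ox)) => [j|j|].
- exact: chart_inv_perp_row.
- by rewrite -chart_partial// cr dotpZl chart_inv_perp_row// mulr0.
- by rewrite chart_euler// dotpZl chart_inv_dotp// mulr1.
Qed.

(** Differentiate [d_j f = <p, d_j psi>]. At a critical point [p = f psi], and the second derivative
    of [psi] is eliminated by [<psi, d_i d_j psi> = - <d_i psi, d_j psi>]. *)
Lemma chart_hessian x : Om x -> (forall j, partial j f x = 0) ->
  hessian f x = (jac p x - f x *: jac psi x) *m (jac psi x)^T.
Proof.
move=> Ox cr; apply/matrixP => i j; rewrite mxE.
have -> : ((jac p x - f x *: jac psi x) *m (jac psi x)^T) i j =
    dotp (row i (jac p x) - f x *: row i (jac psi x)) (row j (jac psi x)).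
  by rewrite mxE; apply: eq_bigr => k _; rewrite !mxE.
rewrite !row_jac_derive; [|by [exact: dpsi|exact: dp]..].
have dJ : differentiable ('D_(delta_mx 0 j) psi) x.
  by apply: Cinf_differentiable (Cinf_derive _ Cpsi) Ox.
have -> : partial i (partial j f) x =
    'D_(delta_mx 0 i) (fun y => dotp (p y) ('D_(delta_mx 0 j) psi y) : R^o) x.
  apply: near_eq_derive; apply: (open_near_eq oOm Ox) => z Oz.
  exact: chart_derive_fun.
rewrite derive_dotp//; last exact: dp.
rewrite (chart_crit Ox cr) dotpZl dotpDl dotpNl dotpZl; congr (_ + _).
have := derive_dotp (delta_mx 0 i) (dpsi Ox) dJ.
have -> : 'D_(delta_mx 0 i) (fun z => dotp (psi z) ('D_(delta_mx 0 j) psi z) : R^o) x =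
    'D_(delta_mx 0 i) (cst 0 : _ -> R^o) x.
  by apply: near_eq_derive; apply: (open_near_eq oOm Ox) => z Oz; exact: chart_inv_perp.
rewrite derive_cst => /eqP; rewrite eq_sym addrC addr_eq0 => /eqP ->.
by rewrite mulrN.
Qed.

Let h : 'rV[R]_n -> R^o := fun y => dotp (p y) (p y).
Let u : 'rV[R]_n -> R^o := fun y => (enorm (p y))^-1.

Lemma chart_grad_sqr_partial j y : Om y ->
  partial j h y = 2 * dotp (p y) ('D_(delta_mx 0 j) p y).
Proof.
move=> Oy; rewrite /partial derive_dotp; [|exact: dp..].
by rewrite dotpC mulr_natl mulr2n.
Qed.

Lemma chart_grad_sqr_crit x : Om x -> (forall j, partial j f x = 0) ->
  forall j, partial j h x = 0.
Proof.
by move=> Ox cr j; rewrite chart_grad_sqr_partial// chart_crit// dotpZl chart_grad_perp// !mulr0.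
Qed.

(** The same computation, starting from [d_j h = 2 <p, d_j p>] and the orthogonality of [psi] and
    [d_j p]. *)
Lemma chart_grad_sqr_hessian x : Om x -> (forall j, partial j f x = 0) ->
  hessian h x = 2 *: ((jac p x - f x *: jac psi x) *m (jac p x)^T).
Proof.
move=> Ox cr; apply/matrixP => i j; rewrite mxE.
have -> : (2 *: ((jac p x - f x *: jac psi x) *m (jac p x)^T)) i j =
    2 * dotp (row i (jac p x) - f x *: row i (jac psi x)) (row j (jac p x)).
  by rewrite !mxE; congr (_ * _); apply: eq_bigr => k _; rewrite !mxE.
rewrite !row_jac_derive; [|by [exact: dpsi|exact: dp]..].
have dJ : differentiable ('D_(delta_mx 0 j) p) x.
  by apply: Cinf_differentiable (Cinf_derive _ Cp) Ox.
have Cd : Cinf Om (fun y => dotp (p y) ('D_(delta_mx 0 j) p y) : R^o).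
  by apply: Cinf_dotp => //; exact: Cinf_derive.
have -> : partial i (partial j h) x =
    'D_(delta_mx 0 i) (2 *: (fun y => dotp (p y) ('D_(delta_mx 0 j) p y) : R^o)) x.
  apply: near_eq_derive; apply: (open_near_eq oOm Ox) => z Oz.
  exact: chart_grad_sqr_partial.
rewrite deriveZ; last by apply: diff_derivable; apply: Cinf_differentiable Cd Ox.
rewrite derive_dotp//; last exact: dp.
rewrite (chart_crit Ox cr) dotpZl dotpDl dotpNl dotpZl; congr (_ * (_ + _)).
have := derive_dotp (delta_mx 0 i) (dpsi Ox) dJ.
have -> : 'D_(delta_mx 0 i) (fun z => dotp (psi z) ('D_(delta_mx 0 j) p z) : R^o) x =
    'D_(delta_mx 0 i) (cst 0 : _ -> R^o) x.
  by apply: near_eq_derive; apply: (open_near_eq oOm Ox) => z Oz; exact: chart_grad_perp.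
rewrite derive_cst => /eqP; rewrite eq_sym addrC addr_eq0 => /eqP ->.
by rewrite mulrN.
Qed.

Lemma chart_grad_neq0 y : Om y -> p y != 0.
Proof. by move=> Oy; apply: grad_neq0 => //; exact: chart_inv_neq0. Qed.

Lemma Cinf_chart_dual : Cinf Om u.
Proof.
have o0 := @open_nonzero R n.+1.
apply: CinfV => // [y Oy|]; first by rewrite gt_eqF// enorm_gt0// chart_grad_neq0.
by apply: (Cinf_comp oOm _ Cp (@Cinf_enorm R n.+1)) => y; exact: chart_grad_neq0.
Qed.

Lemma chart_dual_sqr y : Om y -> u y * u y * h y = 1.
Proof.
move=> Oy; have e0 := enorm_gt0 (chart_grad_neq0 Oy).
by rewrite /h -enorm_sqr /u expr2; field; rewrite gt_eqF.
Qed.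

Lemma Cinf_chart_grad_sqr : Cinf Om h. Proof. exact: Cinf_dotp. Qed.

Lemma chart_dual_partial j y : Om y ->
  partial j u y = - (2^-1 * (u y * u y * u y)) * partial j h y.
Proof.
move=> Oy; apply: derive_inv_sqr.
- exact: Cinf_differentiable Cinf_chart_dual Oy.
- exact: Cinf_differentiable Cinf_chart_grad_sqr Oy.
- by apply: (open_near_eq oOm Oy) => z Oz; rewrite chart_dual_sqr.
Qed.

(** The first derivatives of [h] vanish at [x], so a single term of the product rule survives. *)
Lemma chart_dual_hessian x : Om x -> (forall j, partial j f x = 0) ->
  hessian u x = (- (2^-1 * (u x * u x * u x))) *: hessian h x.
Proof.
move=> Ox cr; apply/matrixP => i j; rewrite !mxE.
pose a : 'rV[R]_n -> R^o := fun y => - (2^-1 * (u y * u y * u y)).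
have Ca : Cinf Om a.
  have Cu := Cinf_chart_dual; apply: CinfN => //; apply: CinfM => //; first exact: Cinf_cst.
  by apply: CinfM => //; exact: CinfM.
have da : derivable a x (delta_mx 0 i).
  by apply: diff_derivable; apply: Cinf_differentiable Ca Ox.
have dh : derivable (partial j h : _ -> R^o) x (delta_mx 0 i).
  apply: diff_derivable; apply: (@Cinf_differentiable _ _ _ Om) => //.
  exact: Cinf_derive Cinf_chart_grad_sqr.
have -> : partial i (partial j u) x = 'D_(delta_mx 0 i) (a * (partial j h : _ -> R^o)) x.
  apply: near_eq_derive; apply: (open_near_eq oOm Ox) => z Oz.
  exact: chart_dual_partial.
by rewrite (deriveM da dh) (chart_grad_sqr_crit Ox cr) scale0r addr0.
Qed.

Lemma chart_dual_nondegenerate x : Om x -> (forall j, partial j f x = 0) ->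
  \det (hessian f x) != 0 ->
  (forall j, partial j u x = 0) /\ \det (hessian u x) != 0.
Proof.
move=> Ox cr nd; split=> [j|].
  by rewrite chart_dual_partial// chart_grad_sqr_crit// mulr0.
rewrite chart_dual_hessian// chart_grad_sqr_hessian//.
have [M uM pM] := chart_grad_factor Ox.
rewrite {2}pM trmx_mul mulmxA -chart_hessian// scalerA detZ det_mulmx det_tr !mulf_neq0//.
- have u0 : u x != 0 by rewrite invr_eq0 gt_eqF// enorm_gt0// chart_grad_neq0.
  by rewrite expf_neq0// mulf_neq0// oppr_eq0 mulf_neq0 ?invr_eq0// !mulf_neq0.
- by move: uM; rewrite unitmxE unitfE.
Qed.

End ChartRelations.

(** * Transfer of non-degenerate critical points to the dual *)

Section Nondegenerate.

Lemma partial_eq (R : realType) n (O : set 'rV[R]_n) (f g : 'rV[R]_n -> R) j x :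
  open O -> (forall y, O y -> f y = g y) -> O x -> partial j f x = partial j g x.
Proof. by move=> oO fg Ox; apply: near_eq_derive; exact: open_near_eq oO Ox fg. Qed.

Lemma hessian_eq (R : realType) n (O : set 'rV[R]_n) (f g : 'rV[R]_n -> R) x :
  open O -> (forall y, O y -> f y = g y) -> O x -> hessian f x = hessian g x.
Proof.
move=> oO fg Ox; apply/matrixP => i j; rewrite [LHS]mxE [RHS]mxE.
by apply: (partial_eq i oO _ Ox) => y Oy; exact: partial_eq oO fg Oy.
Qed.

Context {R : realType} {n : nat} {g d : 'rV[R]_n.+1 -> R}.
Hypothesis gd : dual_pair g d.

Lemma dual_chart_transport U phi psi (B C : set 'rV[R]_n) (T T' : 'rV[R]_n -> 'rV[R]_n) :
  chart U phi psi -> open B -> open C -> B `<=` phi @` U ->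
  Cinf B T -> Cinf C T' ->
  (forall x, B x -> C (T x) /\ T' (T x) = x) ->
  (forall y, C y -> B (T' y) /\ T (T' y) = y) ->
  let U' := [set y | sphere y /\ U (gauss d y) /\ B (phi (gauss d y))] in
  chart U' (T \o phi \o gauss d) (gauss g \o psi \o T') /\
  (T \o phi \o gauss d) @` U' = C.
Proof.
have [[cg cd] _ _ _] := gd.
apply: chart_transport; [exact: Cinf_gauss|exact: Cinf_gauss| |].
- move=> x x1; split; first by apply: gauss_sphere => //; exact: sphere_neq0.
  by have [] := dual_pair_gauss gd x1.
- move=> x x1; split; first by apply: gauss_sphere => //; exact: sphere_neq0.
  by have [] := dual_pair_gauss (dual_pair_sym gd) x1.
Qed.

(** At a critical point the gradient has no tangential part and is a positive multiple of [theta];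
    this is why the antipode appears. *)
Lemma gauss_crit U phi psi theta : chart U phi psi -> U theta ->
  (forall j : 'I_n, partial j (g \o psi) (phi theta) = 0) ->
  gauss g theta = - theta.
Proof.
move=> ch Ut cr; have Ox : (phi @` U) (phi theta) by exists theta.
have [_ t1 _] := chart_sphere ch Ox.
have pt : psi (phi theta) = theta by have [_ _ [h _ _ _]] := ch; exact: (h _ Ut).2.
have := chart_crit gd ch Ox cr; rewrite /= pt /gauss => ->.
have [[[_ g0] _] _ _ _] := gd; rewrite pt in t1.
by rewrite unitvZ ?unitv_id// g0.
Qed.

Lemma dual_nondegenerate theta : 
  nondegenerate_critical_point g theta -> nondegenerate_critical_point d (- theta).
Proof.
move=> [U [phi [psi [ch Ut cr nd]]]].
have Ox : (phi @` U) (phi theta) by exists theta.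
have gt := gauss_crit ch Ut cr.
have oOm := chart_open ch.
have [_ t1 _] := chart_sphere ch Ox.
have pt : psi (phi theta) = theta by have [_ _ [h _ _ _]] := ch; exact: (h _ Ut).2.
rewrite pt in t1.
have [_ _ dgt] := dual_pair_gauss gd t1; rewrite gt in dgt.
have Ci : Cinf (phi @` U) (id : 'rV[R]_n -> 'rV[R]_n) by exact: Cinf_id.
(* No change of coordinates is made: in the transported chart [d] reads [1 / |grad g (psi y)|]. *)
have [ch' _] := dual_chart_transport ch oOm oOm (@subset_refl _ _) Ci Ci
  (fun x Ox => conj Ox erefl) (fun x Ox => conj Ox erefl).
have ag y : (phi @` U) y -> (enorm (grad g (psi y)))^-1 = d (gauss g (psi y)).
  by move=> Oy; have [_ s1 _] := chart_sphere ch Oy; have [] := dual_pair_gauss gd s1.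
have [cr' nd'] := chart_dual_nondegenerate gd ch Ox cr nd.
do 3 eexists; split; first exact: ch'.
- by rewrite /= dgt; split=> //; exact: sphereN.
- move=> j; rewrite [X in partial _ _ X](_ : _ = phi theta); last by rewrite /= dgt.
  by rewrite -(cr' j) (partial_eq j oOm ag Ox).
- rewrite [X in hessian _ X](_ : _ = phi theta); last by rewrite /= dgt.
  by move: nd'; rewrite (hessian_eq oOm ag Ox).
Qed.

End Nondegenerate.

(** * Smooth diagonalization of symmetric matrices *)

Section SmoothSignature.
Context {R : realType}.

Definition index_mx (i m : nat) : 'M[R]_(i + m) := block_mx (- 1%:M) 0 0 1%:M.

(** The upper left block of the inverse is the inverse of the Schur complement [Sg]; the two forms
    take the same value at [w = v Sg] and at [v] respectively. *)
Lemma schur_negative i m (S X : 'M[R]_(i + m)) :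
  S *m X = 1%:M -> drsubmx S \in unitmx ->
  (forall v : 'rV[R]_i, v != 0 -> (v *m ulsubmx X *m v^T) 0 0 < 0) ->
  posdef (- (ulsubmx S - ursubmx S *m invmx (drsubmx S) *m dlsubmx S)).
Proof.
move=> SX uS nX; set Sg := _ - _.
have SgX : Sg *m ulsubmx X = 1%:M.
  move: SX; rewrite -{1}(submxK S) -{1}(submxK X) mulmx_block -[1%:M]submxK.
  move=> /eq_block_mx [E11 _ E21 _]; move: E11 E21.
  rewrite !scalar_mx_block block_mxKul block_mxKdl => E11 E21.
  rewrite /Sg mulmxBl -!mulmxA.
  have -> : dlsubmx S *m ulsubmx X = - (drsubmx S *m dlsubmx X).
    by apply/eqP; rewrite -addr_eq0 E21.
  by rewrite mulmxN mulKmx// mulmxN opprK.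
move=> v v0; rewrite mulmxN mulNmx mxE oppr_gt0.
have uX : ulsubmx X *m Sg = 1%:M by apply: mulmx1C.
have w0 : v *m Sg != 0.
  by apply: contra v0 => /eqP w0; rewrite -[v]mulmx1 -SgX mulmxA w0 mul0mx.
have := nX _ w0; rewrite -(mulmxA v Sg) SgX mulmx1.
have -> : v *m (v *m Sg)^T = (v *m Sg *m v^T)^T by rewrite [RHS]trmx_mul trmxK.
by rewrite mxE.
Qed.

(** Completing squares with respect to the last block. The columns of [Pi] list the [m] positive
    directions before the [i] negative ones. *)
Lemma block_signature i m (S : 'M[R]_(i + m)) (P1 : 'M[R]_i) (P2 : 'M[R]_m) :
  S^T = S -> drsubmx S \in unitmx -> drsubmx S = P2 *m P2^T ->
  - (ulsubmx S - ursubmx S *m invmx (drsubmx S) *m dlsubmx S) = P1 *m P1^T ->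
  let Pi := block_mx (ursubmx S *m invmx (drsubmx S) *m P2) P1 P2 0 : 'M[R]_(i + m, m + i) in
  S = Pi *m (- index_mx m i) *m Pi^T.
Proof.
move=> symS uS E2 E1 Pi.
have s21 : dlsubmx S = (ursubmx S)^T by rewrite trmx_ursub symS.
have s22 : (drsubmx S)^T = drsubmx S by rewrite trmx_drsub symS.
rewrite /Pi /index_mx opp_block_mx opprK !oppr0 tr_block_mx !mulmx_block ?trmx0.
rewrite !(mulmx0, mul0mx, mulmx1, mulmxN, addr0, add0r, oppr0).
set K := ursubmx S *m _ in E1 *.
have KP : K *m P2 *m P2^T = ursubmx S by rewrite -mulmxA -E2 mulmxKV.
have PK : P2 *m (K *m P2)^T = dlsubmx S.
  by rewrite s21 -KP [RHS]trmx_mul trmxK.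
rewrite -(mulmxA K P2) PK KP mulNmx -E1 opprK addrC subrK -E2.
by rewrite submxK.
Qed.

(** Two Cholesky decompositions, of the lower right block and of the opposite of its Schur
    complement. The sign of the latter is read off the inverse [X] at [x0], which is explicit in the
    application. *)
Theorem smooth_signature N i m (U : set 'rV[R]_N) (S : 'rV[R]_N -> 'M[R]_(i + m)) x0
    (X : 'M[R]_(i + m)) :
  open U -> U x0 -> (forall k l, Cinf U (fun x => S x k l : R^o)) ->
  (forall x, U x -> (S x)^T = S x) ->
  posdef (drsubmx (S x0)) -> S x0 *m X = 1%:M ->
  (forall v : 'rV[R]_i, v != 0 -> (v *m ulsubmx X *m v^T) 0 0 < 0) ->
  exists (U' : set 'rV[R]_N) (Pi : 'rV[R]_N -> 'M[R]_(i + m, m + i)),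
    [/\ [/\ open U', U' x0 & U' `<=` U],
        forall k l, Cinf U' (fun x => Pi x k l : R^o) &
        forall x, U' x -> S x = Pi x *m (- index_mx m i) *m (Pi x)^T].
Proof.
move=> oU Ux0 CS symS pS SX nX.
have C22 k l : Cinf U (fun x => drsubmx (S x) k l : R^o).
  by apply: Cinf_ext (CS (rshift i k) (rshift i l)) => x; rewrite !mxE.
have C11 k l : Cinf U (fun x => ulsubmx (S x) k l : R^o).
  by apply: Cinf_ext (CS (lshift m k) (lshift m l)) => x; rewrite !mxE.
have C12 k l : Cinf U (fun x => ursubmx (S x) k l : R^o).
  by apply: Cinf_ext (CS (lshift m k) (rshift i l)) => x; rewrite !mxE.
have C21 k l : Cinf U (fun x => dlsubmx (S x) k l : R^o).
  by apply: Cinf_ext (CS (rshift i k) (lshift m l)) => x; rewrite !mxE.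
have [U2 [P2 [[oU2 U2x0 U2U] CP2 P2E]]] := smooth_cholesky oU Ux0 C22
  (fun x Ux => etrans (trmx_drsub _) (congr1 drsubmx (symS x Ux))) pS.
pose U3 := U2 `&` (fun x => \det (drsubmx (S x)) : R^o) @^-1` [set t | t != 0].
have oU3 : open U3.
  apply: open_preimage_in => // x U2x.
  apply: (@Cinf_continuous _ _ _ U2) => //; apply: Cinf_det => // k l.
  exact: Cinf_sub (C22 _ _).
have uS x : U3 x -> drsubmx (S x) \in unitmx by rewrite unitmxE unitfE => -[].
have U3x0 : U3 x0 by split=> //=; have := posdef_unitmx pS; rewrite unitmxE unitfE.
have U3U2 : U3 `<=` U2 by move=> x [].
have U3U : U3 `<=` U by move=> x /U3U2/U2U.
pose K x := ursubmx (S x) *m invmx (drsubmx (S x)).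
have CK k l : Cinf U3 (fun x => K x k l : R^o).
  apply: Cinf_mulmx => // [k' l'|k' l']; first exact: Cinf_sub (C12 _ _).
  by apply: Cinf_invmx => // k'' l''; exact: Cinf_sub (C22 _ _).
pose Sg x := - (ulsubmx (S x) - K x *m dlsubmx (S x)).
have CSg k l : Cinf U3 (fun x => Sg x k l : R^o).
  have h : Cinf U3 (fun x => - (ulsubmx (S x) k l + - (K x *m dlsubmx (S x)) k l) : R^o).
    apply: CinfN => //; apply: CinfD => //; first exact: Cinf_sub (C11 _ _).
    apply: CinfN => //; apply: Cinf_mulmx => // k' l'; exact: Cinf_sub (C21 _ _).
  by apply: Cinf_ext h => x; rewrite /Sg !mxE.
have symSg x : U3 x -> (Sg x)^T = Sg x.
  move=> /U3U Ux; have sS := symS x Ux.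
  rewrite /Sg /K linearN linearB /= !trmx_mul trmx_inv trmx_ulsub trmx_ursub trmx_dlsub.
  by rewrite trmx_drsub sS mulmxA.
have [U1 [P1 [[oU1 U1x0 U1U3] CP1 P1E]]] := smooth_cholesky oU3 U3x0 CSg symSg
  (schur_negative SX (uS _ U3x0) nX).
exists U1, (fun x => block_mx (K x *m P2 x) (P1 x) (P2 x) 0); split.
- by split=> // x /U1U3/U3U.
- apply: Cinf_block_mx => // k l.
  + apply: Cinf_mulmx => // k' l'; first exact: Cinf_sub (CK _ _).
    by apply: Cinf_sub (CP2 _ _) => x /U1U3/U3U2.
  + by apply: Cinf_sub (CP2 _ _) => x /U1U3/U3U2.
  + by apply: Cinf_ext (Cinf_cst U1 (0 : R^o)) => x; rewrite mxE.
- move=> x U1x; have U3x := U1U3 _ U1x.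
  apply: block_signature => //; [exact/symS/U3U|exact: uS|exact/P2E/U3U2|exact: P1E].
Qed.

End SmoothSignature.

(** * Standard quadratic forms and their derivatives *)

Section MorseIndex.
Context {R : realType}.

Lemma index_mx_sym i m : (index_mx i m)^T = index_mx i m :> 'M[R]_(i + m).
Proof. by rewrite /index_mx tr_block_mx !trmx0 linearN /= !trmx1. Qed.

Lemma index_mx_sqr i m : index_mx i m *m index_mx i m = 1%:M :> 'M[R]_(i + m).
Proof.
rewrite /index_mx mulmx_block !(mulmx0, mul0mx, mulmx1, addr0, add0r) mulmxN mulNmx.
by rewrite mulmx1 opprK -scalar_mx_block.
Qed.

(** The cast lets one identity serve both splittings [i + m] and [m + i] of the dimension. *)
Lemma morse_sumE i m k (E : (i + m)%N = k) (x : 'rV[R]_(i + m)) (r : R) :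
  r - \sum_(j < k | (j < i)%N) (castmx (erefl, E) x) 0 j ^+ 2
    + \sum_(j < k | (i <= j)%N) (castmx (erefl, E) x) 0 j ^+ 2 =
  r + dotp x (x *m index_mx i m).
Proof.
case: k / E; rewrite castmx_id.
rewrite !big_split_ord /=.
rewrite [X in _ - (_ + X)]big_pred0 ?addr0 => [|j]; last by rewrite ltnNge leq_addr.
rewrite [X in _ + (X + _)]big_pred0 ?add0r => [|j]; last by rewrite leqNgt ltn_ord.
rewrite -addrA; congr (_ + _).
rewrite -[x]hsubmxK /index_mx mul_row_block !(mulmx0, addr0, add0r) mulmxN !mulmx1.
rewrite /dotp big_split_ord /=; congr (_ + _).
  rewrite -sumrN; apply: eq_big => [j|j _]; first by rewrite /= ltn_ord.
  by rewrite !row_mxEl [(- lsubmx x) 0 j]mxE mulrN expr2.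
apply: eq_big => [j|j _]; first by rewrite /= leq_addr.
by rewrite !row_mxEr expr2.
Qed.

(** In the product rule the derivative of [A] is multiplied by the argument, which is zero. *)
Lemma jac_mul_at0 N k (U : set 'rV[R]_N) (A : 'rV[R]_N -> 'M[R]_(N, k)) :
  open U -> U 0 -> (forall i j, Cinf U (fun x => A x i j : R^o)) ->
  jac (fun x => x *m A x) 0 = A 0.
Proof.
move=> oU U0 CA; apply/matrixP => i j; rewrite mxE.
have CT : Cinf U (fun x => x *m A x).
  by apply/(Cinf_row _ oU) => l; apply: Cinf_mulmx => // a b; exact: Cinf_coord.
pose b x : 'rV[R]_N := \row_l A x l j.
have Cb : Cinf U b.
  by apply/(Cinf_row _ oU) => l; apply: Cinf_ext (CA l j) => x; rewrite mxE.
rewrite (derive_row_mxE _ _ _ (Cinf_differentiable CT U0)).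
have -> : (fun x => (x *m A x) 0 j : R^o) = (fun x => dotp x (b x) : R^o).
  by apply/funext => x; rewrite mxE; apply: eq_bigr => l _; rewrite mxE.
have di := Cinf_differentiable (@Cinf_id R _ U) U0.
rewrite (derive_dotp _ di (Cinf_differentiable Cb U0)) derive_id.
rewrite [X in _ + X]dotpE mul0mx mxE addr0 dotpE -rowE !mxE //.
Qed.

Lemma hessian_quadratic N (E : 'M[R]_N) (r : R) (x : 'rV[R]_N) : E^T = E ->
  (forall j, partial j (fun x => r + dotp x (x *m E)) x = 2 * (x *m E) 0 j) /\
  hessian (fun x => r + dotp x (x *m E)) x = 2 *: E.
Proof.
move=> symE.
have di y : differentiable (id : 'rV[R]_N -> _) y by exact: (@ex_diff _ _ _ _ _ id id).
have Cm : Cinf setT (fun y : 'rV[R]_N => y *m E).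
  by apply: Cinf_mulmxr; [exact: openT|exact: Cinf_id].
have dm y : differentiable (fun y : 'rV[R]_N => y *m E) y by exact: Cinf_differentiable Cm I.
have Cq : Cinf setT (fun y : 'rV[R]_N => dotp y (y *m E) : R^o).
  by apply: Cinf_dotp => //; [exact: openT|exact: Cinf_id].
have pE j y : partial j (fun x => r + dotp x (x *m E)) y = 2 * (y *m E) 0 j.
  rewrite /partial.
  rewrite (@deriveD _ _ _ (cst r : _ -> R^o) (fun y => dotp y (y *m E) : R^o)) //; last first.
    by apply: diff_derivable; exact: Cinf_differentiable Cq I.
  rewrite derive_cst add0r (derive_dotp _ (di y) (dm y)) derive_id derive_mulmxr// derive_id.
  have -> : dotp y (delta_mx 0 j *m E) = dotp (delta_mx 0 j) (y *m E).
    by rewrite dotpC !dotpE trmx_mul symE mulmxA.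
  have -> : dotp (delta_mx 0 j) (y *m E) = (y *m E) 0 j.
    by rewrite dotpC dotpE trmx_delta -colE mxE.
  by rewrite mulr_natl mulr2n.
split=> [j|]; first exact: pE.
apply/matrixP => i j; rewrite [LHS]mxE [RHS]mxE.
have -> : partial j (fun x => r + dotp x (x *m E)) = (fun y => 2 * (y *m E) 0 j).
  by apply/funext => y; exact: pE.
rewrite /partial (@deriveZ _ _ _ (fun y : 'rV[R]_N => (y *m E) 0 j : R^o)); last first.
  by apply: diff_derivable; exact: differentiable_entry.
by rewrite -(derive_row_mxE _ 0 _ (dm x)) derive_mulmxr// derive_id -rowE mxE.
Qed.

Lemma gram_posdef n q (J : 'M[R]_(n, q)) : row_free J -> posdef (J *m J^T).
Proof.
move=> fJ v v0; rewrite mulmxA -mulmxA -trmx_mul -dotpE dotp_gt0//.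
apply: contra v0 => /eqP vJ; apply/eqP; apply: (row_free_inj fJ).
by rewrite vJ mul0mx.
Qed.

End MorseIndex.

(** * Morse index of the dual *)

Section DualMorse.
Context {R : realType} {i m : nat} {g d : 'rV[R]_(i + m).+1 -> R}
  {U : set 'rV[R]_(i + m).+1} {phi : 'rV[R]_(i + m).+1 -> 'rV[R]_(i + m)}
  {psi : 'rV[R]_(i + m) -> 'rV[R]_(i + m).+1} {theta : 'rV[R]_(i + m).+1}.
Hypothesis gd : dual_pair g d.
Hypothesis ch : chart U phi psi.
Hypothesis Ut : U theta.
Hypothesis phit : phi theta = 0.
Let Om := phi @` U.
Let E := index_mx i m : 'M[R]_(i + m).
Let r := g theta.
Hypothesis morse : forall x, Om x -> g (psi x) = r + dotp x (x *m E).
Let p := grad g \o psi.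
Let J := jac psi.
Let G x := J x *m (J x)^T.

Let oOm : open Om := chart_open ch.
Let Om0 : Om 0. Proof. by exists theta. Qed.
Let psi0 : psi 0 = theta.
Proof. by have [_ _ [h _ _ _]] := ch; rewrite -phit; exact: (h _ Ut).2. Qed.
Let theta1 : sphere theta.
Proof. by have [_ + _] := chart_sphere ch Om0; rewrite psi0. Qed.
Let r0 : 0 < r. Proof. by have [[[_ h] _] _ _ _] := gd; exact: h. Qed.
Let symE : E^T = E. Proof. exact: index_mx_sym. Qed.

Lemma dotp0l b (x : 'rV[R]_b) : dotp 0 x = 0.
Proof. by rewrite dotpE mul0mx mxE. Qed.

Lemma dotp_mulmx_tr a b (x : 'rV[R]_a) (y : 'rV[R]_b) (A : 'M[R]_(b, a)) :
  dotp x (y *m A) = dotp (x *m A^T) y.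
Proof. by rewrite !dotpE trmx_mul mulmxA. Qed.

Lemma morse_partial j y : Om y -> partial j (g \o psi) y = 2 * (y *m E) 0 j.
Proof.
move=> Oy; rewrite (partial_eq (g := fun x => r + dotp x (x *m E)) j oOm _ Oy)//.
by have [h _] := hessian_quadratic r y symE.
Qed.

Lemma morse_crit j : partial j (g \o psi) 0 = 0.
Proof. by rewrite morse_partial// mul0mx mxE mulr0. Qed.

Lemma morse_hessian : hessian (g \o psi) 0 = 2 *: E.
Proof.
rewrite (hessian_eq (g := fun x => r + dotp x (x *m E)) oOm _ Om0)//.
by have [_ h] := hessian_quadratic r 0 symE.
Qed.

Lemma gram_unit y : Om y -> G y \in unitmx.
Proof. by move=> Oy; exact: posdef_unitmx (gram_posdef (chart_jac_free ch Oy)). Qed.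

(** Split [p = f psi + w J] into radial and tangential parts. The partial derivatives of [f] say
    [p J^T = 2 y E], which forces [w = 2 y E G^-1]. *)
Lemma morse_grad_sqr y : Om y ->
  dotp (p y) (p y) = (r + dotp y (y *m E)) ^+ 2
    + 4 * dotp (y *m E) (y *m E *m invmx (G y)).
Proof.
move=> Oy; have fJ := chart_jac_free ch Oy.
have uG := gram_unit Oy.
have pJ j : dotp (p y) (row j (J y)) = 2 * (y *m E) 0 j.
  by rewrite -(chart_partial gd ch) ?morse_partial.
have perp j := chart_inv_perp_row ch j Oy.
have rowE' (w z : 'rV[R]_(i + m).+1) j : dotp w (row j (J y)) = (w *m (J y)^T) 0 j.
  by rewrite mxE; apply: eq_bigr => k _; rewrite !mxE.
have psiJ : psi y *m (J y)^T = 0.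
  by apply/rowP => j; rewrite -rowE'// perp mxE.
pose w := 2 *: (y *m E *m invmx (G y)).
have pE : p y = (r + dotp y (y *m E)) *: psi y + w *m J y.
  apply: (row_perp_eq fJ (chart_inv_dotp ch Oy)) => [|j|].
  - by move=> j; exact: perp.
  - rewrite [LHS]pJ rowE'// mulmxDl -scalemxAl psiJ scaler0 add0r.
    by rewrite -mulmxA -/(G y) /w -scalemxAl mulmxKV// [RHS]mxE.
  - have wJ : dotp (w *m J y) (psi y) = 0.
      by rewrite dotpC dotp_mulmx_tr psiJ dotpE mul0mx mxE.
    by rewrite (chart_euler gd ch)// dotpDl dotpZl (chart_inv_dotp ch)// mulr1 wJ addr0 /= morse.
have pJT : p y *m (J y)^T = 2 *: (y *m E).
  by apply/rowP => j; rewrite -rowE'// pJ [RHS]mxE.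
rewrite {2}pE dotpDr dotpZr (chart_euler gd ch)// /= morse// expr2; congr (_ + _).
by rewrite dotp_mulmx_tr pJT /w dotpZl dotpZr; ring.
Qed.

Let c y : R := (r * enorm (p y) * (r + enorm (p y)))^-1.

(** With [e = |p|], use [1/r - 1/e = (e^2 - r^2) / (r e (r + e))]: [c] is the inverse of the
    denominator, and the matrix it multiplies represents [e^2 - r^2]. *)
Definition dual_form y : 'M[R]_(i + m) :=
  c y *: ((2 * r + dotp y (y *m E)) *: E + 4 *: (E *m invmx (G y) *m E)).

Let pn0 y : Om y -> 0 < enorm (p y).
Proof. by move=> Oy; rewrite enorm_gt0// (chart_grad_neq0 gd ch Oy). Qed.

Lemma dual_form_eq y : Om y ->
  (enorm (p y))^-1 = r^-1 - dotp y (y *m dual_form y).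
Proof.
move=> Oy; have e0 := pn0 Oy.
have := morse_grad_sqr Oy; rewrite -enorm_sqr /dual_form /c.
rewrite -scalemxAr mulmxDr -!scalemxAr dotpZr dotpDr !dotpZr.
have -> : dotp y (y *m (E *m invmx (G y) *m E)) = dotp (y *m E) (y *m E *m invmx (G y)).
  by rewrite !mulmxA dotp_mulmx_tr symE.
move: (dotp (y *m E) _) (dotp y _) (enorm (p y)) r0 e0 => t k e.
move: r => s s0 e0 eq.
have -> : (2 * s + k) * k + 4 * t = e ^+ 2 - s ^+ 2 by rewrite eq; ring.
by field; rewrite !gt_eqF// addr_gt0.
Qed.

Lemma dual_form_sym y : Om y -> (dual_form y)^T = dual_form y.
Proof.
move=> Oy; rewrite /dual_form linearZ linearD !linearZ /= !trmx_mul trmx_inv symE.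
by rewrite /G trmx_mul trmxK mulmxA.
Qed.

Lemma Cinf_dual_form k l : Cinf Om (fun y => dual_form y k l : R^o).
Proof.
have Cpsi := Cinf_chart_inv ch.
have o0 := @open_nonzero R (i + m).+1.
have Ce : Cinf Om (fun y => enorm (p y) : R^o).
  apply: (Cinf_comp oOm _ (Cinf_chart_grad gd ch) (@Cinf_enorm R _)) => y.
  exact: (chart_grad_neq0 gd ch).
have Cc : Cinf Om (c : _ -> R^o).
  apply: CinfV => // [y /pn0 e0|]; first by rewrite gt_eqF// !mulr_gt0// addr_gt0.
  have Cr : Cinf Om (fun=> r : R^o) by exact: Cinf_cst.
  by apply: CinfM => //; [exact: CinfM|exact: CinfD].
have CJ a b : Cinf Om (fun y => J y a b : R^o) by exact: Cinf_jac.
have CG a b : Cinf Om (fun y => G y a b : R^o).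
  apply: Cinf_mulmx => // a' b'.
  by apply: Cinf_ext (CJ b' a') => y; rewrite [RHS]mxE.
have CEG a b : Cinf Om (fun y => (E *m invmx (G y) *m E) a b : R^o).
  apply: Cinf_mulmx => // a' b'; last exact: Cinf_cst.
  apply: Cinf_mulmx => // a'' b''; first exact: Cinf_cst.
  by apply: Cinf_invmx => // y; exact: gram_unit.
have Cq : Cinf Om (fun y => dotp y (y *m E) : R^o).
  by apply: Cinf_dotp => //; [|apply: Cinf_mulmxr => //]; exact: Cinf_id.
have h : Cinf Om (fun y => c y * ((2 * r + dotp y (y *m E)) * E k l +
    4 * (E *m invmx (G y) *m E) k l) : R^o).
  apply: CinfM => //; apply: CinfD => //; apply: CinfM => //; try exact: Cinf_cst.
  by apply: CinfD => //; exact: Cinf_cst.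
by apply: Cinf_ext h => y; rewrite /dual_form [RHS]mxE [in RHS]mxE [in RHS]mxE [in X in _ = _ * (_ + X)]mxE.
Qed.

Let c0 : 0 < c 0.
Proof. by have e0 := pn0 Om0; rewrite invr_gt0 !mulr_gt0// addr_gt0. Qed.

Let mx0 := 2 *: E + r *: G 0.

(** Comparing the Hessian [2 E] with [(P - r J) J^T] at the critical point gives
    [2 E + r G = P J^T = M G]. *)
Lemma dual_mx_unit : mx0 \in unitmx.
Proof.
have [M uM PM] := chart_grad_factor gd ch Om0.
have := chart_hessian gd ch Om0 morse_crit.
rewrite morse_hessian PM /= psi0 -/r mulmxBl -scalemxAl -mulmxA -/J -/(G 0) => H.
have -> : mx0 = M *m G 0 by rewrite /mx0 H subrK.
by rewrite unitmx_mul uM gram_unit.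
Qed.

Let p0 : p 0 = r *: theta.
Proof. by rewrite [LHS](chart_crit gd ch Om0 morse_crit) /= psi0. Qed.

(** The support inequality between [psi y] and [- theta], where [d] equals [1 / r], rewritten with
    [<psi y, theta> = 1 - |psi y - theta|^2 / 2]. *)
Lemma morse_support y : Om y -> 0 <= dotp y (y *m E) + r / 2 * dotp (psi y - psi 0) (psi y - psi 0).
Proof.
move=> Oy; have [_ s1 _] := chart_sphere ch Oy.
have [_ dE _] := dual_pair_gauss gd theta1.
have gt : gauss g theta = - theta.
  by rewrite -psi0 /gauss; have := p0; rewrite /p /= => ->; rewrite unitvZ// unitv_id// psi0.
have [_ h _ _] := gd.
have := h _ _ s1 (sphereN theta1); rewrite dotpNr opprK.
have pt : enorm (grad g theta) = r.
  by have := p0; rewrite /p /= psi0 => ->; rewrite enormZ// (theta1 : enorm theta = 1) mulr1.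
rewrite -gt dE pt morse// psi0 !(dotpDl, dotpDr, dotpNl, dotpNr) !sphere_dotp//.
rewrite (dotpC theta) => H.
have : dotp (psi y) theta * r <= r + dotp y (y *m E) by rewrite -ler_pdivlMr.
move: (dotp _ theta) (dotp y _) => a b; lra.
Qed.

(* Second-order expansion of the support inequality along the ray t v. *)
Lemma dual_mx_psd (v : 'rV[R]_(i + m)) : 0 <= (v *m mx0 *m v^T) 0 0.
Proof.
have dpsi : differentiable psi 0 by exact: Cinf_differentiable (Cinf_chart_inv ch) Om0.
pose F (w : 'rV[R]_(i + m).+1) : R^o := dotp v (v *m E) + r / 2 * dotp w w.
have FE : (v *m mx0 *m v^T) 0 0 = 2 * F (v *m J 0).
  rewrite /F /mx0 mulmxDr mulmxDl -!scalemxAr -!scalemxAl mxE [X in X + _]mxE [X in _ + X]mxE.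
  rewrite /G !mulmxA -[_ *m _ *m _ *m v^T]mulmxA -trmx_mul -!dotpE [dotp (v *m E) v]dotpC.
  by rewrite mulrDr; congr (_ + _); field.
rewrite FE mulr_ge0// -derive_jac//.
have cF : continuous F.
  move=> w; apply: (@Cinf_continuous _ _ _ setT _ _ _ I).
  have oT := @openT 'rV[R]_(i + m).+1.
  apply: CinfD => //; first exact: Cinf_cst.
  apply: CinfM => //; first exact: Cinf_cst.
  by apply: Cinf_dotp => //; exact: Cinf_id.
have Fcl : closed [set w | 0 <= F w].
  by apply: (@closed_comp _ _ F [set t | 0 <= t]); [move=> w _; exact: cF|exact: closed_ge].
have dv : derivable psi 0 v by exact: diff_derivable.
(* Divided by [t^2], the support inequality at [t v] says that [F] is nonnegative at this difference
   quotient; the closed condition passes to the limit. *)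
pose q (t : R) : 'rV[R]_(i + m).+1 := t^-1 *: ((psi \o shift 0) (t *: v) - psi 0).
have qv : q @ (0 : R)^' --> 'D_v psi 0 by exact: dv.
suff nq : \forall t \near (0 : R)^', [set w | 0 <= F w] (q t) by exact: (@closed_cvg _ _ _ _ q (fun w => 0 <= F w) Fcl nq _ qv).
have nOm : \forall t \near (0 : R)^', Om (t *: v).
  apply: cvg_within; have : (fun t : R => t *: v) @ 0 --> (0 : 'rV[R]_(i + m)).
    by rewrite -[X in _ --> X](scale0r v); exact: scalel_continuous.
  by apply; exact: open_nbhs_nbhs.
near=> t.
have tn0 : t != 0 by near: t; exact: nbhs_dnbhs_neq.
have Otv : Om (t *: v) by near: t.
have := morse_support Otv; rewrite /F /q /= addr0.
rewrite -scalemxAl !dotpZl !dotpZr => h.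
have t2 : 0 < t * t by rewrite -expr2 exprn_even_gt0.
rewrite -(pmulr_rge0 _ t2); apply: le_trans h _; rewrite le_eqVlt; apply/orP; left; apply/eqP.
by field.
Unshelve. all: by end_near. Qed.

Let mx0_sym : mx0^T = mx0.
Proof. by rewrite /mx0 linearD !linearZ /= symE /G trmx_mul trmxK. Qed.

Let dual_form0 : dual_form 0 = c 0 *: (2 *: (E *m invmx (G 0) *m mx0)).
Proof.
rewrite /dual_form mul0mx dotp0l addr0 /mx0 mulmxDr -!scalemxAr.
rewrite mulmxKV ?gram_unit//; congr (_ *: _).
by rewrite [RHS]scalerDr !scalerA -natrM addrC.
Qed.

Let dual_inv := (c 0)^-1 *: ((2 * r)^-1 *: (E - 2 *: invmx mx0)).

(** Since [E^2 = 1], the product [E G^-1 (2 E + r G) (E - 2 (2 E + r G)^-1)] collapses to [r]. *)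
Lemma dual_formV : dual_form 0 *m dual_inv = 1%:M.
Proof.
rewrite dual_form0 /dual_inv -!scalemxAr -!scalemxAl !scalerA.
have -> : E *m invmx (G 0) *m mx0 *m (E - 2 *: invmx mx0) = r *: 1%:M.
  rewrite mulmxBr -scalemxAr mulmxK ?dual_mx_unit//.
  rewrite /mx0 mulmxDr mulmxDl -!scalemxAr mulmxKV ?gram_unit// -!scalemxAl.
  by rewrite index_mx_sqr -mulmxA index_mx_sqr mulmx1 addrAC subrr add0r.
rewrite scalerA -[RHS]scale1r; congr (_ *: _).
by field; rewrite !gt_eqF.
Qed.

Lemma ulsubmx_form (A : 'M[R]_(i + m)) (v : 'rV[R]_i) :
  v *m ulsubmx A *m v^T = row_mx v 0 *m A *m (row_mx v 0)^T.
Proof.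
rewrite -{2}(submxK A) mul_row_block tr_row_mx mul_row_col.
by rewrite !(mul0mx, mulmx0, addr0, trmx0).
Qed.

Lemma drsubmx_form (A : 'M[R]_(i + m)) (v : 'rV[R]_m) :
  v *m drsubmx A *m v^T = row_mx 0 v *m A *m (row_mx 0 v)^T.
Proof.
rewrite -{2}(submxK A) mul_row_block tr_row_mx mul_row_col.
by rewrite !(mul0mx, mulmx0, add0r, trmx0).
Qed.

Lemma mulmx_inv_form k (A : 'M[R]_k) (v : 'rV[R]_k) : A \in unitmx -> A^T = A ->
  v *m invmx A *m v^T = (v *m invmx A) *m A *m (v *m invmx A)^T.
Proof. by move=> uA sA; rewrite trmx_mul trmx_inv sA mulmxKV// mulmxA. Qed.

(** On the first block [E] contributes [- |v|^2]; the inverse of the nonnegative matrix [mx0] is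
    nonnegative and is subtracted. *)
Lemma dual_inv_negative (v : 'rV[R]_i) : v != 0 ->
  (v *m ulsubmx dual_inv *m v^T) 0 0 < 0.
Proof.
have ci0 : 0 < (c 0)^-1 by rewrite invr_gt0.
move=> v0; rewrite ulsubmx_form /dual_inv -!scalemxAr -!scalemxAl mxE pmulr_rlt0//.
rewrite mxE pmulr_rlt0 ?invr_gt0 ?mulr_gt0//.
rewrite mulmxBr mulmxBl -scalemxAr -scalemxAl.
rewrite (mulmx_inv_form _ dual_mx_unit mx0_sym).
have h := dual_mx_psd (row_mx v 0 *m invmx mx0).
rewrite mxE [X in _ + X]mxE [X in _ - X]mxE.
have -> : row_mx v 0 *m E *m (row_mx v 0)^T = - (v *m v^T).
  rewrite /E /index_mx mul_row_block tr_row_mx mul_row_col.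
  by rewrite !(mul0mx, mulmx0, addr0, trmx0) mulmxN mulmx1 mulNmx.
rewrite mxE -dotpE; have := dotp_gt0 v0; move: h.
move: (fun_of_matrix _ 0 0) (dotp v v) => a b; lra.
Qed.

(** On the last block [E] acts as the identity: up to the factor [c 0], the form is [2 r |v|^2] plus
    a nonnegative term from [G^-1]. *)
Lemma dual_form_posdef : posdef (drsubmx (dual_form 0)).
Proof.
move=> v v0; rewrite drsubmx_form /dual_form mul0mx dotp0l addr0.
rewrite -scalemxAr -scalemxAl mxE mulr_gt0//.
rewrite mulmxDr mulmxDl -!scalemxAr -!scalemxAl mxE.
have -> : row_mx 0 v *m E = row_mx 0 v.
  by rewrite /E /index_mx mul_row_block !(mul0mx, mulmx0, add0r, addr0, mulmx1).
have -> : row_mx 0 v *m (E *m invmx (G 0) *m E) *m (row_mx 0 v)^T =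
    row_mx 0 v *m invmx (G 0) *m (row_mx 0 v)^T.
  rewrite !mulmxA -[_ *m E *m _^T]mulmxA.
  have -> : E *m (row_mx 0 v)^T = (row_mx 0 v)^T.
    rewrite -[LHS]trmxK trmx_mul trmxK symE.
    by rewrite /E /index_mx mul_row_block !(mul0mx, mulmx0, add0r, addr0, mulmx1).
  by rewrite /E /index_mx mul_row_block !(mul0mx, mulmx0, add0r, addr0, mulmx1).
rewrite mulmx_inv_form ?gram_unit//; last by rewrite /G trmx_mul trmxK.
apply: ltr_pwDl; rewrite mxE.
  rewrite mulr_gt0 ?mulr_gt0// tr_row_mx mul_row_col trmx0 mul0mx add0r -dotpE.
  exact: dotp_gt0.
by rewrite mulr_ge0// mulmx_tr_ge0.
Qed.

Lemma mulmx_castmx a b k l (e : k = l) (x : 'M[R]_(a, b)) (A : 'M[R]_(b, k)) :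
  x *m castmx (erefl, e) A = castmx (erefl, e) (x *m A).
Proof. by case: l / e; rewrite !castmx_id. Qed.

Lemma mxrank_castmx b k l (e : k = l) (A : 'M[R]_(b, k)) : \rank (castmx (erefl, e) A) = \rank A.
Proof. by case: l / e; rewrite castmx_id. Qed.

Theorem dual_morse_chart : morse_index d (- theta) m.
Proof.
have [U' [Pi [[oU' U'0 U'Om] CPi PiE]]] := smooth_signature oOm Om0
  Cinf_dual_form dual_form_sym dual_form_posdef dual_formV dual_inv_negative.
pose e := addnC m i.
pose A x := castmx (erefl, e) (Pi x).
have CA k l : Cinf U' (fun x => A x k l : R^o).
  by apply: Cinf_ext (CPi k (cast_ord (esym e) l)) => x; rewrite /A castmxE cast_ord_id.
pose T x := x *m A x.
have CT : Cinf U' T.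
  by apply/(Cinf_row _ oU') => l; apply: Cinf_mulmx => // a b; exact: Cinf_coord.
(* [Pi 0] is the left factor of the invertible matrix [dual_form 0], so it has full rank. *)
have uA : A 0 \in unitmx.
  have uS : dual_form 0 \in unitmx by have [] := mulmx1_unit dual_formV.
  rewrite -row_free_unit /row_free eqn_leq rank_leq_row /=.
  rewrite mxrank_castmx -{1}(mxrank_unit uS) PiE// -mulmxA; exact: mxrankM_maxl.
have T0 : T 0 = 0 by rewrite /T mul0mx.
have uT : jac T 0 \in unitmx by rewrite (jac_mul_at0 oU' U'0 CA).
have [B [C [T' [[oB oC B0 BU'] TP T'P CT']]]] := inverse_function oU' U'0 CT uT.
have BOm : B `<=` Om by move=> x /BU'/U'Om.
have [ch' imC] := dual_chart_transport gd ch oB oC BOm (Cinf_sub BU' CT) CT' TP T'P.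
have [_ dgt dgt'] := dual_pair_gauss gd theta1.
have gt : gauss g theta = - theta.
  by apply: (gauss_crit gd ch Ut) => j; rewrite phit; exact: morse_crit.
rewrite gt in dgt dgt'.
do 3 eexists; split; first exact: ch'.
- by rewrite /= dgt' phit; split=> //; exact: sphereN.
- by rewrite /= dgt' phit.
move=> y; rewrite imC => Cy; have [Bx Ty] := T'P _ Cy.
have Ox := BOm _ Bx; have [_ s1 _] := chart_sphere ch Ox.
have [_ dE _] := dual_pair_gauss gd s1.
rewrite /= dE (dual_form_eq Ox) dgt.
have -> : enorm (grad g theta) = r.
  by have := p0; rewrite /p /= psi0 => ->; rewrite enormZ// (theta1 : enorm theta = 1) mulr1.
move: (T' y) Bx Ty {Ox s1 dE} => x Bx Ty.
rewrite -Ty /T /A mulmx_castmx morse_sumE; congr (_ + _).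
(* The minus sign in front of the quadratic form cancels that of [- index_mx m i], which leaves
   index [m]. *)
rewrite (PiE _ (BU' _ Bx)) mulmxN mulNmx mulmxN dotpNr opprK.
by rewrite !mulmxA [LHS]dotp_mulmx_tr trmxK.
Qed.

End DualMorse.

(** Eliminating the equation [i + m = n] brings the dimension to the shape in which the block
    matrices are typed. *)
Lemma dual_morse_index (R : realType) n (g d : 'rV[R]_n.+1 -> R) theta i :
  dual_pair g d -> (i <= n)%N -> morse_index g theta i ->
  morse_index d (- theta) (n - i).
Proof.
move=> gd le_in; move: (n - i)%N (subnKC le_in) => m E {le_in}.
case: n / E g d theta gd => g d theta gd [U [phi [psi [ch Ut phit morse]]]].
apply: (dual_morse_chart gd ch Ut phit) => x Ox.
by rewrite morse// -(morse_sumE (erefl (i + m)%N) x) castmx_id.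
Qed.

Theorem theorem3 (R : realType) (n : nat) (n_gt0 : (0 < n)%N)
    (gamma delta : 'rV[R]_n.+1 -> R)
    (gamma_smooth : Cinf_pos gamma)
    (gamma_sconvex : strictly_convex_integrand gamma)
    (delta_dual : dual_integrand gamma delta)
    (delta_smooth : Cinf_pos delta)
    (gamma_stable : stable gamma) :
  (forall theta0 : 'rV[R]_n.+1, sphere theta0 ->
     (nondegenerate_critical_point gamma theta0 <->
      nondegenerate_critical_point delta (- theta0))) /\
  (forall theta0 : 'rV[R]_n.+1, sphere theta0 ->
     nondegenerate_critical_point gamma theta0 ->
     forall i : nat, (i <= n)%N ->
       (morse_index gamma theta0 i <-> morse_index delta (- theta0) (n - i))).
Proof.
have gd := dual_integrand_pair gamma_smooth delta_smooth gamma_sconvex.1 delta_dual.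
have dg := dual_pair_sym gd.
(* The converses are the same implications for [(delta, gamma)] at [- theta], with
   [- - theta = theta] and [n - (n - i) = i]. *)
split=> [theta _|theta _ _ i le_in]; split.
- exact: (dual_nondegenerate gd).
- by move=> /(dual_nondegenerate dg); rewrite opprK.
- exact: (dual_morse_index gd le_in).
- by move=> /(dual_morse_index dg (leq_subr i n)); rewrite opprK subKn.
Qed.
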